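(* Let $\mathbb{A}$ be any set of allowable test processes, and let $I=[\underline{p},\overline{p}]\in\mathcal{I}$ be any interval forecast. Then there is a path $\omega\in\Omega$ that is $\mathbb{A}$-random (and therefore also Schnorr random) for the stationary forecasting system $\gamma_I$, but that is not Schnorr random (and therefore not $\mathbb{A}$-random) for any computable forecasting system $\varphi\colon\mathbb{S}\to\mathcal{I}$ satisfying $\sup_{s\in\mathbb{S}}\left[\overline{\varphi}(s)-\underline{\varphi}(s)\right]<\overline{p}-\underline{p}$.
   Context: Notation: $\mathbb{N}=\{1,2,\dots\}$, $\mathbb{N}_0=\mathbb{N}\cup\{0\}$. Situations are the finite binary sequences $\mathbb{S}=\bigcup_{n\in\mathbb{N}_0}\{0,1\}^n$, with $\square$ the empty sequence; $sx$ is $s$ with $x\in\{0,1\}$ appended. Paths are elements $\omega$ of $\Omega=\{0,1\}^{\mathbb{N}}$; $\omega_{1:n}\in\mathbb{S}$ consists of the first $n$ entries. $\mathcal{I}$ is the set of non-empty closed subintervals of $[0,1]$ (interval forecasts). For $f\colon\{0,1\}\to\mathbb{R}$ and $I\in\mathcal{I}$, $\overline{E}_I(f)=\max_{p\in I}[pf(1)+(1-p)f(0)]$. A forecasting system is a map $\varphi\colon\mathbb{S}\to\mathcal{I}$, with $\underline{\varphi}(s)=\min\varphi(s)$ and $\overline{\varphi}(s)=\max\varphi(s)$. For $I\in\mathcal{I}$, the stationary forecasting system $\gamma_I$ is given by $\gamma_I(s)=I$ for all $s\in\mathbb{S}$. A real process is a map $F\colon\mathbb{S}\to\mathbb{R}$,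 with $\Delta F(s)(x)=F(sx)-F(s)$. A test process is a non-negative real process with $F(\square)=1$. A supermartingale for $\varphi$ is a real process $M$ with $\overline{E}_{\varphi(s)}(\Delta M(s))\le 0$ for all $s\in\mathbb{S}$; a test supermartingale for $\varphi$ is a test process that is a supermartingale for $\varphi$. Computability: ''recursive'' means computable by a Turing machine (countable sets such as $\mathbb{S}$ and $\mathbb{S}\times\mathbb{N}_0$ are identified with $\mathbb{N}_0$ by recursive bijections with recursive inverse). A real process $F$ is computable if there are a recursive family of rationals $r_{s,n}$ ($s\in\mathbb{S}$, $n\in\mathbb{N}_0$) and a recursive map $e\colon\mathbb{S}\times\mathbb{N}_0\to\mathbb{N}_0$ such that $n\ge e(s,N)$ implies $|r_{s,n}-F(s)|\le 2^{-N}$. The same definition applies to maps on $\mathbb{N}_0$. A forecasting system $\varphi$ is computable if the real processes $\underline{\varphi}$ and $\overline{\varphi}$ are. A set of allowable test processes is any countable set $\mathbb{A}$ of test processes that contains all computable (strictly) positive test processes. A path $\omega$ is $\mathbb{A}$-random for $\varphi$ if $\sup_{n\in\mathbb{N}}T(\omega_{1:n})<\infty$ for every $T\in\mathbb{A}$ that is a test supermartingale for $\varphi$. A growth function is a recursive, non-decreasing, unbounded map $\rho\colon\mathbb{N}_0\to\mathbb{N}_0$. A path $\omega$ is Schnorr random for $\varphi$ if $\limsup_{n\to\infty}[T(\omega_{1:n})-\rho(n)]\le 0$ for all computable test supermartingales $T$ for $\varphi$ and all growth functions $\rho$. *)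

(* Defs.v *)
From Stdlib Require Cantor.
From mathcomp Require Import all_boot all_order all_algebra.
From mathcomp Require Import all_classical all_reals all_analysis.
From mathcomp Require Import zify.

Set Implicit Arguments.
Unset Strict Implicit.
Unset Printing Implicit Defensive.

Import Order.TTheory GRing.Theory Num.Theory.

Local Open Scope classical_set_scope.
Local Open Scope ring_scope.

Variant tm_move := MoveLeft | Stay | MoveRight.

(* Deterministic single-tape machines.  The machine halts when [tm_delta]
   returns [None].  The tape is infinite to the right only; moving left from
   cell 0 leaves the head on cell 0. *)
Record turing_machine := TuringMachine {
  tm_state : finType;
  tm_symbol : finType;
  tm_start : tm_state;
  tm_blank : tm_symbol;
  tm_mark : tm_symbol;
  tm_mark_neq_blank : tm_mark != tm_blank;
  tm_delta : tm_state -> tm_symbol -> option (tm_state * tm_symbol * tm_move)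
}.

Record tm_config (M : turing_machine) := TMConfig {
  tm_cur : tm_state M;
  tm_tape : nat -> tm_symbol M;
  tm_head : nat
}.

Definition tm_move_head (d : tm_move) (h : nat) : nat :=
  match d with MoveLeft => h.-1 | Stay => h | MoveRight => h.+1 end.

Definition tm_step (M : turing_machine) (c : tm_config M) :
    option (tm_config M) :=
  match tm_delta (tm_cur c) (tm_tape c (tm_head c)) with
  | None => None
  | Some (q, a, d) =>
      Some (TMConfig q
        (fun i => if i == tm_head c then a else tm_tape c i)
        (tm_move_head d (tm_head c)))
  end.

Definition tm_init (M : turing_machine) (n : nat) : tm_config M :=
  TMConfig (tm_start M)
    (fun i => if (i < n)%N then tm_mark M else tm_blank M) 0.

(* Unary output: the tape starts with exactly [m] marks followed by a blank;
   what lies beyond that blank is ignored. *)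
Definition tm_output (M : turing_machine) (c : tm_config M) (m : nat) : Prop :=
  (forall i, (i < m)%N -> tm_tape c i = tm_mark M) /\ tm_tape c m = tm_blank M.

Definition tm_computes (M : turing_machine) (f : nat -> nat) : Prop :=
  forall n, exists (k : nat) (c : tm_config M),
    [/\ iter k (obind (@tm_step M)) (Some (tm_init M n)) = Some c,
        tm_step c = None & tm_output c (f n)].

Definition recursive (f : nat -> nat) : Prop :=
  exists M : turing_machine, tm_computes M f.

(* The digit 1 is [true], the digit 0 is [false]; [rcons s x] is s followed
   by x. *)
Definition situation := seq bool.

(* The entry with index k+1 of a path in {0,1}^{1,2,...} is [w k]. *)
Definition bpath := nat -> bool.

Definition prefix_of (w : bpath) (n : nat) : situation := mkseq w n.

(* The rank of s in the length-lexicographic enumeration of binary strings: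
   the empty string has code 0 and (rcons s x) has code 2 * code s + 1 + x. *)
Definition scode (s : situation) : nat :=
  foldl (fun c (x : bool) => c.*2.+1 + x)%N 0 s.

Lemma scode_bij : bijective scode.
Proof.
have scode_rcons s x : scode (rcons s x) = ((scode s).*2.+1 + x)%N.
  by rewrite /scode foldl_rcons.
have inj : injective scode.
  move=> s; elim/last_ind: s => [|s x IH] t; case/lastP: t => [|t y] //.
  - by rewrite scode_rcons.
  - by rewrite scode_rcons.
  rewrite !scode_rcons => e.
  have xy : x = y by move: e; case: x; case: y => //=; lia.
  by rewrite -xy in e *; rewrite (IH t) //; lia.
have surj n : exists s, scode s = n.
  have [m] := ubnP n; elim: m n => // m IH [|n] lt_nm; first by exists [::].
  have [|s es] := IH n./2; first by lia.
  by exists (rcons s (odd n)); rewrite scode_rcons es; lia.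
exists (fun n => projT1 (cid (surj n))) => [s|n].
  by apply: inj; rewrite (projT2 (cid (surj _))).
by rewrite (projT2 (cid (surj n))).
Qed.

Definition sncode (p : situation * nat) : nat :=
  Cantor.to_nat (scode p.1, p.2).

Lemma sncode_bij : bijective sncode.
Proof.
have [g gK Kg] := scode_bij.
exists (fun n => (g (Cantor.of_nat n).1, (Cantor.of_nat n).2)) => [[s n]|n].
  by rewrite /sncode Cantor.cancel_of_to /= gK.
rewrite /sncode; case E: (Cantor.of_nat n) => [a b].
by rewrite [(_, _).1]/= Kg -E Cantor.cancel_to_of.
Qed.

Definition recursive_sn (f : situation -> nat -> nat) : Prop :=
  exists2 g : nat -> nat, recursive g & forall s n, g (sncode (s, n)) = f s n.

Definition recursive_rat (r : situation -> nat -> rat) : Prop :=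
  exists sg a b : situation -> nat -> nat,
    [/\ recursive_sn sg, recursive_sn a, recursive_sn b,
        forall s n, b s n != 0%N
      & forall s n, r s n = (-1) ^+ sg s n * (a s n)%:R / (b s n)%:R].

Definition real_process (R : realType) := situation -> R.

Definition computable_process (R : realType) (F : real_process R) : Prop :=
  exists (r : situation -> nat -> rat) (e : situation -> nat -> nat),
    [/\ recursive_rat r, recursive_sn e
      & forall s N n, (e s N <= n)%N -> `|ratr (r s n) - F s| <= 2%:R ^- N].

Definition process_diff (R : realType) (F : real_process R) (s : situation)
  (x : bool) : R := F (rcons s x) - F s.

Definition test_process (R : realType) (F : real_process R) : Prop :=
  (forall s, 0 <= F s) /\ F [::] = 1.

Definition positive_process (R : realType) (F : real_process R) : Prop :=
  forall s, 0 < F s.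

(* The non-empty closed interval [[ilo, ihi]] included in [[0, 1]]. *)
Record interval_forecast (R : realType) := IntervalForecast {
  ilo : R;
  ihi : R;
  ilo_ge0 : 0 <= ilo;
  ilo_le_ihi : ilo <= ihi;
  ihi_le1 : ihi <= 1
}.

Definition expectation_at (R : realType) (f : bool -> R) (p : R) : R :=
  p * f true + (1 - p) * f false.

(* A supremum over a compact interval of a continuous function, that is, a
   maximum. *)
Definition upper_expectation (R : realType) (I : interval_forecast R)
  (f : bool -> R) : R := sup (expectation_at f @` `[ilo I, ihi I]).

Definition forecasting_system (R : realType) :=
  situation -> interval_forecast R.

Definition computable_fs (R : realType) (phi : forecasting_system R) : Prop :=
  computable_process (fun s => ilo (phi s)) /\
  computable_process (fun s => ihi (phi s)).

Definition stationary (R : realType) (I : interval_forecast R) :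
  forecasting_system R := fun=> I.

Definition supermartingale (R : realType) (phi : forecasting_system R)
    (M : real_process R) : Prop :=
  forall s, upper_expectation (phi s) (process_diff M s) <= 0.

Definition test_supermartingale (R : realType) (phi : forecasting_system R)
    (T : real_process R) : Prop :=
  test_process T /\ supermartingale phi T.

Definition allowable (R : realType) (A : set (real_process R)) : Prop :=
  [/\ countable A,
      forall T, A T -> test_process T
    & forall T, test_process T -> positive_process T ->
        computable_process T -> A T].

Definition random_for (R : realType) (A : set (real_process R))
    (phi : forecasting_system R) (w : bpath) : Prop :=
  forall T, A T -> test_supermartingale phi T ->
    (ereal_sup [set (T (prefix_of w n))%:E | n in [set n | (0 < n)%N]]
       < +oo)%E.

Definition growth_function (rho : nat -> nat) : Prop :=
  [/\ recursive rho,
      {homo rho : m n / (m <= n)%N}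
    & forall B : nat, exists n, (B < rho n)%N].

Definition schnorr_random (R : realType) (phi : forecasting_system R)
    (w : bpath) : Prop :=
  forall T, test_supermartingale phi T -> computable_process T ->
  forall rho, growth_function rho ->
    (limn_esup (fun n => (T (prefix_of w n) - (rho n)%:R)%:E) <= 0)%E.

(* Main.v *)
(* Only countably many rational betting strategies matter, so one forecast can be
   set against all of them.  Enumerate the recursive maps b_k : S -> {0,1} and let
   the precise, non-computable system psi forecast max I or min I at s according to
   b_k(s), where the index k = rank |s| takes each value infinitely often.  Since
   psi(s) lies in I, supermartingales for gamma_I are supermartingales for psi, and
   any countable set of those stays bounded along some path w.  If phi is computable
   and uniformly narrower than I, some b_k decides recursively whether
   max phi(s) <= q1 < max I or min phi(s) >= q0 > min I.  Betting on 1 in the first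
   case and on 0 in the second, at the levels of rank k only, gives a computable
   supermartingale T for phi.  Under psi the reciprocal of T shrinks on average by a
   constant factor c > 1 at each such level, so U = c^(number of these levels) / T is
   again a supermartingale for psi.  The countable set for which w was chosen
   contains U, hence T grows exponentially in the number of levels of rank k.
   To see that T is computable, Turing machines are shown to be equivalent to
   while-programs over registers, for which closure properties are easy. *)
From Stdlib Require Cantor.
Require Import Defs.
From mathcomp Require Import all_boot all_order all_algebra.
From mathcomp Require Import all_classical all_reals all_analysis.
From mathcomp Require Import zify ring lra.

Set Implicit Arguments.
Unset Strict Implicit.
Unset Printing Implicit Defensive.

(** * Compilation of register programs to Turing machines *)

Inductive prog :=
  | Inc of nat
  | Dec of nat
  | Seq of prog & prog
  | If of nat & prog & prog
  | While of nat & prog.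

Definition upd (v : nat -> nat) j x := fun i => if i == j then x else v i.

Inductive exec : prog -> (nat -> nat) -> (nat -> nat) -> Prop :=
  | ExInc j v : exec (Inc j) v (upd v j (v j).+1)
  | ExDec j v : exec (Dec j) v (upd v j (v j).-1)
  | ExSeq p q u v w : exec p u v -> exec q v w -> exec (Seq p q) u w
  | ExIfT j p q v w : 0 < v j -> exec p v w -> exec (If j p q) v w
  | ExIfF j p q v w : v j = 0 -> exec q v w -> exec (If j p q) v w
  | ExWhileF j p v : v j = 0 -> exec (While j p) v v
  | ExWhileT j p u v w :
      0 < u j -> exec p u v -> exec (While j p) v w -> exec (While j p) u w.

(** A program thus computes at most one function, which the enumeration by program codes relies
    on. *)
Lemma exec_det p u v w : exec p u v -> exec p u w -> v = w.
Proof.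
move=> uv; elim: uv w => {p u v}.
- by move=> j v w e; inversion e.
- by move=> j v w e; inversion e.
- move=> p q u v w _ IHp _ IHq w' e; inversion e; subst.
  by apply: IHq; rewrite (IHp _ H1).
- move=> j p q v w v0 _ IH w' e; inversion e; subst; first exact: IH.
  by rewrite H4 in v0.
- move=> j p q v w v0 _ IH w' e; inversion e; subst; last exact: IH.
  by rewrite v0 in H4.
- move=> j p v v0 w e; inversion e; subst => //.
  by rewrite v0 in H1.
- move=> j p u v w u0 _ IHp _ IHw w' e; inversion e; subst.
    by rewrite H3 in u0.
  by apply: IHw; rewrite (IHp _ H2).
Qed.

Fixpoint max_reg p : nat :=
  match p with
  | Inc j | Dec j => j
  | Seq p q => maxn (max_reg p) (max_reg q)
  | If j p q => maxn j (maxn (max_reg p) (max_reg q))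
  | While j p => maxn j (max_reg p)
  end.

Section Tracks.

Variable k : nat.

(* One track per register, holding its value in unary; the boolean flags cell
   0, so that a machine can find the left end of its tape. *)
Let sym : finType := (bool * {set 'I_k.+1})%type.

Definition reg_tape (v : nat -> nat) : nat -> sym :=
  fun i => (i == 0, [set j : 'I_k.+1 | i < v j]).

Definition move_table (Q : finType) := Q -> sym -> option (Q * sym * tm_move).

Inductive steps (Q : finType) (d : move_table Q) :
    Q -> (nat -> sym) -> nat -> Q -> (nat -> sym) -> nat -> Prop :=
  | Steps0 q t h : steps d q t h q t h
  | StepsS q t h q1 a m q' t' h' : d q (t h) = Some (q1, a, m) ->
      steps d q1 (fun i => if i == h then a else t i) (tm_move_head m h) q' t' h' ->
      steps d q t h q' t' h'.

Lemma steps_trans (Q : finType) (d : move_table Q) q t h q1 t1 h1 q2 t2 h2 :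
  steps d q t h q1 t1 h1 -> steps d q1 t1 h1 q2 t2 h2 -> steps d q t h q2 t2 h2.
Proof. by elim=> // *; apply: StepsS; eauto. Qed.

Lemma write_same (t : nat -> sym) h : (fun i => if i == h then t h else t i) = t.
Proof. by apply: funext => i; case: eqP => [->|]. Qed.

Lemma steps_move (Q : finType) (d : move_table Q) q t h q1 m q' t' h' :
  d q (t h) = Some (q1, t h, m) -> steps d q1 t (tm_move_head m h) q' t' h' ->
  steps d q t h q' t' h'.
Proof. by move=> e s; apply: (StepsS e); rewrite write_same. Qed.

(** Only moves have to be preserved, not halting, so a composite machine may go on from a state in
    which its component has stopped. *)
Lemma steps_embed (Q Q' : finType) (d : move_table Q) (d' : move_table Q')
    (f : Q -> Q') :
  (forall q a q1 b m, d q a = Some (q1, b, m) -> d' (f q) a = Some (f q1, b, m)) ->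
  forall q t h q' t' h', steps d q t h q' t' h' ->
  steps d' (f q) t h (f q') t' h'.
Proof.
move=> df q t h q' t' h'; elim=> [|{}q {}t {}h q1 a m {}q' {}t' {}h' e _ IH].
  by constructor.
by apply: StepsS IH; apply: df.
Qed.

(** The head is on cell 0 at both ends, so that runs can be chained; the state where [d] stops is
    the point at which another machine takes over. *)
Definition runs_to (Q : finType) (q0 : Q) (d : move_table Q) v w :=
  exists2 q, steps d q0 (reg_tape v) 0 q (reg_tape w) 0 &
    d q (reg_tape w 0) = None.

Lemma in_reg_tape v i j : j <= k -> (inord j \in (reg_tape v i).2) = (i < v j).
Proof. by move=> jk; rewrite inE inordK. Qed.

Lemma steps_scan (Q : finType) (d : move_table Q) q v j :
  (forall i, i < v j ->
    d q (reg_tape v i) = Some (q, reg_tape v i, MoveRight)) ->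
  steps d q (reg_tape v) 0 q (reg_tape v) (v j).
Proof.
move=> dq; suff: forall m, m <= v j -> steps d q (reg_tape v) 0 q (reg_tape v) m.
  exact.
elim=> [|m IH] lt_m; first by constructor.
apply: (steps_trans (IH (ltnW lt_m))).
by apply: (@steps_move _ d _ (reg_tape v) m _ MoveRight); [exact: dq | constructor].
Qed.

Lemma steps_return (Q : finType) (d : move_table Q) q v h :
  (forall a, ~~ a.1 -> d q a = Some (q, a, MoveLeft)) ->
  steps d q (reg_tape v) h q (reg_tape v) 0.
Proof.
move=> dq; elim: h => [|h IH]; first by constructor.
by apply: (@steps_move _ d _ (reg_tape v) h.+1 _ MoveLeft _ _ _ _ IH); apply: dq.
Qed.

Lemma reg_tape_add v j : j <= k ->
  (fun i => if i == v j
     then ((reg_tape v (v j)).1, inord j |: (reg_tape v (v j)).2)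
     else reg_tape v i) = reg_tape (upd v j (v j).+1).
Proof.
move=> jk; apply: funext => i; rewrite /reg_tape /upd.
case: eqP => [->|ne] /=; congr pair; apply/setP => l; rewrite !inE.
  have -> : (l == inord j) = (l == j :> nat) by rewrite -val_eqE /= inordK.
  by case: (nat_of_ord l =P j) => [->|_] /=; rewrite ?ltnS ?leqnn.
by case: (nat_of_ord l =P j) => [->|_] //; lia.
Qed.

Lemma reg_tape_del v j : j <= k ->
  (fun i => if i == (v j).-1
     then ((reg_tape v (v j).-1).1, (reg_tape v (v j).-1).2 :\ inord j)
     else reg_tape v i) = reg_tape (upd v j (v j).-1).
Proof.
move=> jk; apply: funext => i; rewrite /reg_tape /upd.
case: eqP => [->|ne] /=; congr pair; apply/setP => l; rewrite !inE.
  have -> : (l == inord j) = (l == j :> nat) by rewrite -val_eqE /= inordK.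
  by case: (nat_of_ord l =P j) => [->|_] /=; rewrite ?ltnn.
by case: (nat_of_ord l =P j) => [->|_] //; lia.
Qed.

(** Scan right to the first cell without a mark on track [j], put one there, and return to the
    flag. *)
Lemma compile_inc j : j <= k ->
  exists (Q : finType) (q0 : Q) d, forall v, runs_to q0 d v (upd v j (v j).+1).
Proof.
move=> jk; pose d (q : bool) (a : sym) :=
  if q then (if a.1 then None else Some (true, a, MoveLeft))
  else if inord j \in a.2 then Some (false, a, MoveRight)
  else Some (true, (a.1, inord j |: a.2), Stay).
exists bool, false, d => v; exists true => //.
apply: (@steps_trans _ _ _ _ _ false (reg_tape v) (v j)).
  by apply: steps_scan => i lt_i; rewrite /d in_reg_tape // lt_i.
apply: (@StepsS _ _ _ _ _ true ((reg_tape v (v j)).1, inord j |: (reg_tape v (v j)).2) Stay).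
  by rewrite /d in_reg_tape // ltnn.
by rewrite reg_tape_add //; apply: steps_return => a /negbTE; rewrite /d => ->.
Qed.

(** The first free cell is one too far, hence the step left before the deletion. On an empty
    register that step stays on cell 0 and the deletion changes nothing, in agreement with
    [0.-1 = 0]. *)
Lemma compile_dec j : j <= k ->
  exists (Q : finType) (q0 : Q) d, forall v, runs_to q0 d v (upd v j (v j).-1).
Proof.
move=> jk; pose d (q : option bool) (a : sym) :=
  match q with
  | None => Some (Some true, (a.1, a.2 :\ inord j), Stay)
  | Some true => if a.1 then None else Some (Some true, a, MoveLeft)
  | Some false => if inord j \in a.2 then Some (Some false, a, MoveRight)
                  else Some (None, a, MoveLeft)
  end.
exists (option bool), (Some false), d => v; exists (Some true) => //.
apply: (@steps_trans _ _ _ _ _ (Some false) (reg_tape v) (v j)).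
  by apply: steps_scan => i lt_i; rewrite /d in_reg_tape // lt_i.
apply: (@steps_move _ _ _ _ _ None MoveLeft).
  by rewrite /d in_reg_tape // ltnn.
apply: (@StepsS _ _ _ _ _ (Some true)
  ((reg_tape v (v j).-1).1, (reg_tape v (v j).-1).2 :\ inord j) Stay) => //.
by rewrite reg_tape_del //; apply: steps_return => a /negbTE; rewrite /d => ->.
Qed.

(** Control flow lives in the state set: components are joined in a disjoint sum, and an extra state
    [None] performs tests. The head then rests on cell 0, whose marks tell which registers are
    non-zero. *)
Lemma compile p : max_reg p <= k ->
  exists (Q : finType) (q0 : Q) (d : move_table Q),
    forall v w, exec p v w -> runs_to q0 d v w.
Proof.
elim: p => [j|j|p IHp q IHq|j p IHp q IHq|j p IHp] /=.
- move=> /compile_inc [Q [q0 [d dP]]]; exists Q, q0, d => v w e.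
  by inversion e; subst.
- move=> /compile_dec [Q [q0 [d dP]]]; exists Q, q0, d => v w e.
  by inversion e; subst.
- rewrite geq_max => /andP[/IHp [P [p0 [dp pP]]] /IHq [Q [q0 [dq qP]]]].
  pose d (x : P + Q) (a : sym) := match x with
    | inl y => if dp y a is Some (z, b, m) then Some (inl z, b, m)
               else Some (inr q0, a, Stay)
    | inr y => if dq y a is Some (z, b, m) then Some (inr z, b, m) else None
    end.
  exists (P + Q)%type, (inl p0), d => u w e; inversion e; subst.
  have [x sx hx] := pP _ _ H1; have [y sy hy] := qP _ _ H4.
  exists (inr y); last by rewrite /= hy.
  apply: (@steps_trans _ _ _ _ _ (inl x) (reg_tape v) 0).
    by apply: (steps_embed (f := inl)) sx => q' a q1 b m /= ->.
  apply: (@steps_move _ _ _ _ _ (inr q0) Stay); first by rewrite /= hx.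
  by apply: (steps_embed (f := inr)) sy => q' a q1 b m /= ->.
- rewrite !geq_max => /andP[jk /andP[/IHp [P [p0 [dp pP]]] /IHq [Q [q0 [dq qP]]]]].
  pose d (x : option (P + Q)) (a : sym) := match x with
    | None => Some (Some (if inord j \in a.2 then inl p0 else inr q0), a, Stay)
    | Some (inl y) =>
        if dp y a is Some (z, b, m) then Some (Some (inl z), b, m) else None
    | Some (inr y) =>
        if dq y a is Some (z, b, m) then Some (Some (inr z), b, m) else None
    end.
  exists (option (P + Q)), None, d => v w e; inversion e; subst.
    have [x sx hx] := pP _ _ H5; exists (Some (inl x)); last by rewrite /= hx.
    apply: (@steps_move _ _ _ _ _ (Some (inl p0)) Stay).
      by rewrite /d in_reg_tape // H4.
    by apply: (steps_embed (f := Some \o inl)) sx => q' a q1 b m /= ->.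
  have [x sx hx] := qP _ _ H5; exists (Some (inr x)); last by rewrite /= hx.
  apply: (@steps_move _ _ _ _ _ (Some (inr q0)) Stay).
    by rewrite /d in_reg_tape // H4.
  by apply: (steps_embed (f := Some \o inr)) sx => q' a q1 b m /= ->.
- rewrite geq_max => /andP[jk /IHp [P [p0 [dp pP]]]].
  pose d (x : option P) (a : sym) := match x with
    | None => if inord j \in a.2 then Some (Some p0, a, Stay) else None
    | Some y => if dp y a is Some (z, b, m) then Some (Some z, b, m)
                else Some (None, a, Stay)
    end.
  exists (option P), None, d => v w; move Ep': (While j p) => p' e.
  exists None; last first.
    elim: e Ep' => // j' p1 v0 v1 [e1 _]; subst.
    by rewrite /d in_reg_tape // v1.
  elim: e Ep' => // [j' p1 v0 v1 [e1 e2]|]; first by constructor.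
  move=> j' p1 u v0 w' u0 e1 _ _ IH [? ?]; subst.
  apply: (@steps_move _ _ _ _ _ (Some p0) Stay).
    by rewrite /d in_reg_tape // u0.
  have [x sx hx] := pP _ _ e1.
  apply: (@steps_trans _ _ _ _ _ (Some x) (reg_tape v0) 0).
    by apply: (steps_embed (f := Some)) sx => q' a q1 b m /= ->.
  by apply: (@steps_move _ d (Some x) (reg_tape v0) 0 None Stay _ _ _ _ (IH erefl)); rewrite /= hx.
Qed.

Definition unflagged_tape n : nat -> sym :=
  fun i => (false, if i < n then [set ord0] else finset.set0).

Definition one_reg (n : nat) : nat -> nat := fun i => if i == 0 then n else 0.

Lemma reg_tape_one n : reg_tape (one_reg n) =
  fun i => if i == 0 then (true, (unflagged_tape n 0).2) else unflagged_tape n i.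
Proof.
apply: funext => i; have e (m : nat) :
    [set j : 'I_k.+1 | m < one_reg n j] = (unflagged_tape n m).2.
  apply/setP => j; rewrite !inE /one_reg /=.
  have -> : (j == 0 :> nat) = (j == ord0) by [].
  by case E: (j == ord0); case: (m < n); rewrite !inE ?E ?ltn0.
by rewrite /reg_tape e; case: eqP => [->|].
Qed.

(** Input and output tapes carry no flag, so state [None] sets it at the start and the transition
    into [Some None] removes it at the end. The symbol [mk] has a mark on track 0 only, which is why
    all other registers must end at zero. *)
Lemma recursive_of_compile (Q : finType) (q0 : Q) (d : move_table Q) f :
  (forall n, runs_to q0 d (one_reg n) (one_reg (f n))) -> recursive f.
Proof.
move=> run; pose mk : sym := (false, [set ord0]); pose bl : sym := (false, finset.set0).
have mk_bl : mk != bl.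
  by apply/eqP => -[] /setP/(_ ord0); rewrite !inE eqxx.
pose d' (x : option (option Q)) (a : sym) := match x with
  | None => Some (Some (Some q0), (true, a.2), Stay)
  | Some None => None
  | Some (Some y) => if d y a is Some (z, b, m) then Some (Some (Some z), b, m)
                     else Some (Some None, (false, a.2), Stay)
  end.
pose M := @TuringMachine (option (option Q)) sym None bl mk mk_bl d'.
have sound q t h q' t' h' : steps d' q t h q' t' h' ->
    exists k, iter k (obind (@tm_step M)) (Some (@TMConfig M q t h)) =
              Some (@TMConfig M q' t' h').
  elim=> [{}q {}t {}h|{}q {}t {}h q1 a m {}q' {}t' {}h' e _ [l IH]].
    by exists 0.
  by exists l.+1; rewrite iterSr /= /tm_step /= e.
exists M => n; have [q sq hq] := run n.
have [|l lP] := sound None (unflagged_tape n) 0 (Some None) (unflagged_tape (f n)) 0.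
  apply: (@StepsS _ _ _ _ _ (Some (Some q0)) (true, (unflagged_tape n 0).2) Stay) => //.
  rewrite -reg_tape_one /=.
  apply: (@steps_trans _ _ _ _ _ (Some (Some q)) (reg_tape (one_reg (f n))) 0).
    by apply: (steps_embed (f := Some \o Some)) sq => x a q1 b m /= ->.
  apply: (@StepsS _ _ _ _ _ (Some None) (false, (reg_tape (one_reg (f n)) 0).2) Stay).
    by rewrite /= hq.
  rewrite reg_tape_one /=; set t := (t in steps _ _ t).
  suff -> : t = unflagged_tape (f n) by constructor.
  by rewrite {}/t; apply: funext => i; case: eqP => // ->.
exists l, (@TMConfig M (Some None) (unflagged_tape (f n)) 0); split=> //.
  rewrite -lP; congr (iter _ _ (Some _)); rewrite /tm_init /=; congr TMConfig.
  by apply: funext => i; rewrite /unflagged_tape; case: ifP.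
split=> [i lt_i|] /=; first by rewrite /unflagged_tape lt_i.
by rewrite /unflagged_tape ltnn.
Qed.

End Tracks.

Lemma recursive_of_prog p f :
  (forall n, exec p (one_reg n) (one_reg (f n))) -> recursive f.
Proof.
move=> pf; have [Q [q0 [d dP]]] := compile (leqnn (max_reg p)).
by apply: (recursive_of_compile (q0 := q0) (d := d)) => n; apply: dP.
Qed.

(** * Functions computed by register programs *)

Lemma exec_eq p v w w' : exec p v w -> w = w' -> exec p v w'.
Proof. by move=> ? <-. Qed.

Definition clear i := While i (Dec i).
Definition add i j := While i (Seq (Dec i) (Inc j)).
Definition add2 i j k := While i (Seq (Dec i) (Seq (Inc j) (Inc k))).

Lemma exec_clear i v : exec (clear i) v (upd v i 0).
Proof.
move En: (v i) => n; elim: n v En => [|n IH] v vi.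
  apply: (exec_eq (ExWhileF _ vi)); apply: funext => j.
  by rewrite /upd; case: eqP => // ->.
apply: ExWhileT; [by rewrite vi | exact: ExDec |].
apply: (exec_eq (IH _ _)); first by rewrite /upd eqxx vi.
by apply: funext => j; rewrite /upd; case: eqP.
Qed.

Lemma exec_add i j v : i != j -> exec (add i j) v (upd (upd v j (v j + v i)) i 0).
Proof.
move=> /eqP ij; move En: (v i) => n; elim: n v En => [|n IH] v vi.
  apply: (exec_eq (ExWhileF _ vi)); apply: funext => l.
  by rewrite /upd; case: eqP => [->//|_]; case: eqP => // ->; lia.
apply: ExWhileT; [by rewrite vi | by apply: ExSeq; [exact: ExDec | exact: ExInc] |].
apply: (exec_eq (IH _ _)); first by rewrite /upd; do 2 case: eqP => //; lia.
apply: funext => l; rewrite /upd; case: (l =P i) => // li; case: (l =P j) => // lj.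
by rewrite eqxx; case: eqP => [|_]; lia.
Qed.

Lemma exec_add2 i j k v : i != j -> i != k -> j != k ->
  exec (add2 i j k) v (upd (upd (upd v k (v k + v i)) j (v j + v i)) i 0).
Proof.
move=> /eqP ij /eqP ik /eqP jk; move En: (v i) => n; elim: n v En => [|n IH] v vi.
  apply: (exec_eq (ExWhileF _ vi)); apply: funext => l.
  rewrite /upd; case: (l =P i) => [->//|_]; case: (l =P j) => [->|_]; first by lia.
  by case: (l =P k) => [->|//]; lia.
apply: ExWhileT; first by rewrite vi.
  by apply: ExSeq; [exact: ExDec | apply: ExSeq; exact: ExInc].
apply: (exec_eq (IH _ _)).
  by rewrite /upd; case: eqP => //; case: eqP => //; rewrite eqxx vi.
apply: funext => l; rewrite /upd; case: (l =P i) => // li; case: (l =P j) => [lj|_].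
  by rewrite eqxx; do 2 (case: eqP => //); lia.
case: (l =P k) => // lk; rewrite eqxx.
by do 2 (case: eqP => //); lia.
Qed.

(* Registers below [b] hold [v], those from [b] on hold [l] followed by zeros. *)
Definition st (v : nat -> nat) b (l : seq nat) : nat -> nat :=
  fun j => if j < b then v j else nth 0 l (j - b).

Lemma st_eq v b l l' : nth 0 l =1 nth 0 l' -> st v b l = st v b l'.
Proof. by move=> e; apply: funext => j; rewrite /st e. Qed.

Lemma st_nth v b l i : st v b l (b + i) = nth 0 l i.
Proof. by rewrite /st ifF; [congr nth|]; lia. Qed.

Lemma st_upd v b l i x : upd (st v b l) (b + i) x = st v b (set_nth 0 l i x).
Proof.
apply: funext => j; rewrite /upd /st nth_set_nth /=.
case: (j =P b + i) => [->|ne]; first by rewrite ifF ?addKn ?eqxx; lia.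
by case: (ltnP j b) => // jb; rewrite ifF //; lia.
Qed.

(** Moves the border by one, so that a program with base [b.+1] leaves the value in register [b]
    alone. *)
Lemma st_cons v b x l : st v b (x :: l) = st (st v b [:: x]) b.+1 l.
Proof.
apply: funext => j; rewrite /st ltnS; case: (ltngtP j b) => [//|jb|->].
  by rewrite (_ : j - b = (j - b.+1).+1) //; lia.
by rewrite subnn.
Qed.

Lemma st_rcons0 v b l : st v b (rcons l 0) = st v b l.
Proof.
apply: st_eq => i; rewrite nth_rcons; case: ltngtP => // [lt_i|->].
  by rewrite nth_default // ltnW.
by rewrite nth_default.
Qed.

Section Straight.

Variables (v : nat -> nat) (b : nat) (l : seq nat).

Lemma st_inc i : exec (Inc (b + i)) (st v b l) (st v b (set_nth 0 l i (nth 0 l i).+1)).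
Proof. by apply: (exec_eq (ExInc _ _)); rewrite st_nth st_upd. Qed.

Lemma st_dec i : exec (Dec (b + i)) (st v b l) (st v b (set_nth 0 l i (nth 0 l i).-1)).
Proof. by apply: (exec_eq (ExDec _ _)); rewrite st_nth st_upd. Qed.

Lemma st_clear i : exec (clear (b + i)) (st v b l) (st v b (set_nth 0 l i 0)).
Proof. by apply: (exec_eq (exec_clear _ _)); rewrite st_upd. Qed.

Lemma st_add i j : i != j -> exec (add (b + i) (b + j)) (st v b l)
  (st v b (set_nth 0 (set_nth 0 l j (nth 0 l j + nth 0 l i)) i 0)).
Proof.
move=> ij; apply: (exec_eq (exec_add _ _)); first by rewrite eqn_add2l.
by rewrite !st_nth !st_upd.
Qed.

Lemma st_add2 i j k : i != j -> i != k -> j != k ->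
  exec (add2 (b + i) (b + j) (b + k)) (st v b l)
  (st v b (set_nth 0 (set_nth 0 (set_nth 0 l k (nth 0 l k + nth 0 l i))
     j (nth 0 l j + nth 0 l i)) i 0)).
Proof.
move=> ij ik jk; apply: (exec_eq (exec_add2 _ _ _ _)); rewrite ?eqn_add2l //.
by rewrite !st_nth !st_upd.
Qed.

End Straight.

Definition dup b := Seq (add2 (b + 0) (b + 1) (b + 2)) (add (b + 2) (b + 0)).

Lemma st_dup v b x : exec (dup b) (st v b [:: x]) (st v b [:: x; x]).
Proof.
apply: ExSeq; first exact: st_add2.
by apply: (exec_eq (st_add _ _ _ _)) => //=; exact: (st_rcons0 _ _ [:: x; x]).
Qed.

Definition swap b :=
  Seq (add (b + 0) (b + 2)) (Seq (add (b + 1) (b + 0)) (add (b + 2) (b + 1))).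

Lemma st_swap v b x y : exec (swap b) (st v b [:: x; y]) (st v b [:: y; x]).
Proof.
apply: ExSeq; first exact: st_add.
apply: ExSeq; first exact: st_add.
apply: (exec_eq (st_add _ _ _ _)) => //=; exact: (st_rcons0 _ _ [:: y; x]).
Qed.

(** The Cantor code is [y] plus the triangular number of [x + y]; the loop adds the numbers from
    [x + y] down to 1 to a copy of [y]. *)
Definition cantor_pair b :=
  Seq (add2 (b + 1) (b + 0) (b + 2))
 (Seq (While (b + 0)
         (Seq (add2 (b + 0) (b + 2) (b + 3)) (Seq (add (b + 3) (b + 0)) (Dec (b + 0)))))
      (add (b + 2) (b + 0))).

Lemma st_pair v b x y :
  exec (cantor_pair b) (st v b [:: x; y]) (st v b [:: Cantor.to_nat (x, y)]).
Proof.
apply: ExSeq; first exact: st_add2.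
rewrite [set_nth _ _ _ _]/= add0n.
have loop a c : exec (While (b + 0)
         (Seq (add2 (b + 0) (b + 2) (b + 3)) (Seq (add (b + 3) (b + 0)) (Dec (b + 0)))))
    (st v b [:: a; 0; c]) (st v b [:: 0; 0; c + nat_rec _ 0 (fun i m => i.+1 + m) a]).
  elim: a c => [|a IH] c; first by apply: (exec_eq (ExWhileF _ _)); rewrite ?st_nth //= addn0.
  apply: ExWhileT; first by rewrite st_nth.
    apply: ExSeq; first exact: st_add2.
    apply: ExSeq; first exact: st_add.
    exact: st_dec.
  rewrite /= (st_rcons0 _ _ [:: a; 0; c + a.+1]).
  by apply: (exec_eq (IH _)); rewrite /= addnA.
apply: ExSeq; first exact: loop.
apply: (exec_eq (st_add _ _ _ _)) => //=; rewrite add0n.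
have -> : [:: y + nat_rec _ 0 (fun i m => i.+1 + m) (x + y); 0; 0] =
  rcons (rcons [:: Cantor.to_nat (x, y)] 0) 0.
  by rewrite /Cantor.to_nat /= (_ : x + y = (y + x)%coq_nat) //; lia.
by rewrite !st_rcons0.
Qed.

(** Walks along the diagonals for [n] steps: [(x.+1, y)] is followed by [(x, y.+1)], and [(0, y)] by
    [(y.+1, 0)]. *)
Definition cantor_unpair b := While (b + 0)
  (Seq (Dec (b + 0)) (If (b + 1) (Seq (Dec (b + 1)) (Inc (b + 2)))
                                 (Seq (add (b + 2) (b + 1)) (Inc (b + 1))))).

Lemma st_unpair v b n : exec (cantor_unpair b) (st v b [:: n])
  (st v b [:: 0; (Cantor.of_nat n).1; (Cantor.of_nat n).2]).
Proof.
suff loop k : exec (cantor_unpair b)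
    (st v b [:: n; (Cantor.of_nat k).1; (Cantor.of_nat k).2])
    (st v b [:: 0; (Cantor.of_nat (n + k)).1; (Cantor.of_nat (n + k)).2]).
  have := loop 0; rewrite addn0 /=.
  by rewrite (st_rcons0 _ _ [:: n; 0]) (st_rcons0 _ _ [:: n]).
elim: n k => [|n IH] k; first by apply: ExWhileF; rewrite st_nth.
apply: (@ExWhileT _ _ _ (st v b [:: n; (Cantor.of_nat k.+1).1; (Cantor.of_nat k.+1).2])).
- by rewrite st_nth.
- apply: ExSeq; first exact: st_dec.
  have -> : Cantor.of_nat k.+1 = let: (x, y) := Cantor.of_nat k in
      if x is x'.+1 then (x', y.+1) else (y.+1, 0) by [].
  case: (Cantor.of_nat k) => [[|x] y] /=.
    apply: ExIfF; first by rewrite st_nth.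
    by apply: ExSeq; [exact: st_add | exact: st_inc].
  apply: ExIfT; first by rewrite st_nth.
  by apply: ExSeq; [exact: st_dec | exact: st_inc].
- by rewrite addSnnS; apply: IH.
Qed.

Lemma st_fst v b x y :
  exec (Seq (cantor_unpair b) (Seq (clear (b + 2)) (add (b + 1) (b + 0))))
    (st v b [:: Cantor.to_nat (x, y)]) (st v b [:: x]).
Proof.
apply: ExSeq; first exact: st_unpair.
rewrite Cantor.cancel_of_to; apply: ExSeq; first exact: st_clear.
apply: (exec_eq (st_add _ _ _ _)) => //=.
by rewrite (st_rcons0 _ _ [:: x; 0]) (st_rcons0 _ _ [:: x]).
Qed.

Lemma st_snd v b x y :
  exec (Seq (cantor_unpair b) (Seq (clear (b + 1)) (add (b + 2) (b + 0))))
    (st v b [:: Cantor.to_nat (x, y)]) (st v b [:: y]).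
Proof.
apply: ExSeq; first exact: st_unpair.
rewrite Cantor.cancel_of_to; apply: ExSeq; first exact: st_clear.
apply: (exec_eq (st_add _ _ _ _)) => //=.
by rewrite (st_rcons0 _ _ [:: y; 0]) (st_rcons0 _ _ [:: y]).
Qed.

(** * Recursive maps between encoded types *)

Class encodable (T : Type) := enc : T -> nat.

Instance nat_enc : encodable nat := id.
Instance bool_enc : encodable bool := nat_of_bool.
Instance prod_enc A B (eA : encodable A) (eB : encodable B) : encodable (A * B) :=
  fun p => Cantor.to_nat (enc p.1, enc p.2).
Instance situation_enc : encodable situation := scode.

(** For each base [b] the program must keep the registers below it and return the work space above
    it clean; this is what makes such maps compose and pair. Nothing is asked at numbers that are
    not codes. *)
Definition rec A B {eA : encodable A} {eB : encodable B} (f : A -> B) :=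
  forall b, exists p, forall v a, exec p (st v b [:: enc a]) (st v b [:: enc (f a)]).

Section RecClosure.

Context {A B C : Type}.
Context {eA : encodable A} {eB : encodable B} {eC : encodable C}.

Lemma rec_ext (f g : A -> B) : f =1 g -> rec f -> rec g.
Proof. by move=> /funext ->. Qed.

(** There is no empty program; clearing register [b.+1], which is already zero, stands in for it. *)
Lemma rec_cast (f : A -> B) : (forall a, enc (f a) = enc a) -> rec f.
Proof.
by move=> e b; exists (clear b.+1) => v a; rewrite e;
   apply: (exec_eq (exec_clear _ _)); apply: funext => j; rewrite /upd;
   case: eqP => // ->; rewrite /st ltnNge leqnSn subSnn.
Qed.

Lemma rec_recode (f : A -> B) (g : A -> C) :
  (forall a, enc (g a) = enc (f a)) -> rec f -> rec g.
Proof. by move=> e rf b; have [p pf] := rf b; exists p => v a; rewrite e. Qed.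

Lemma rec_comp (f : A -> B) (g : B -> C) : rec f -> rec g -> rec (fun a => g (f a)).
Proof.
move=> rf rg b; have [p pf] := rf b; have [q qg] := rg b.
by exists (Seq p q) => v a; apply: ExSeq.
Qed.

(** Each component runs with base [b.+1] while register [b] holds what must survive: first the
    argument, then, after the swap, the value of [f]. *)
Lemma rec_pair (f : A -> B) (g : A -> C) :
  rec f -> rec g -> rec (fun a => (f a, g a)).
Proof.
move=> rf rg b; have [p pf] := rf b.+1; have [q qg] := rg b.+1.
exists (Seq (dup b) (Seq p (Seq (swap b) (Seq q (cantor_pair b))))) => v a.
apply: ExSeq; first exact: st_dup.
apply: ExSeq; first by rewrite (st_cons _ _ _ [:: _]); apply: pf.
rewrite -st_cons; apply: ExSeq; first exact: st_swap.
apply: ExSeq; first by rewrite (st_cons _ _ _ [:: _]); apply: qg.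
by rewrite -st_cons; apply: st_pair.
Qed.

Lemma rec_fst (f : A -> B * C) : rec f -> rec (fun a => (f a).1).
Proof.
move=> rf b; have [p pf] := rf b.
by eexists (Seq p _) => v a; apply: ExSeq; [exact: pf | exact: st_fst].
Qed.

Lemma rec_snd (f : A -> B * C) : rec f -> rec (fun a => (f a).2).
Proof.
move=> rf b; have [p pf] := rf b.
by eexists (Seq p _) => v a; apply: ExSeq; [exact: pf | exact: st_snd].
Qed.

Lemma rec_cst (c : B) : rec (fun _ : A => c).
Proof.
move=> b; exists (Seq (clear (b + 0)) (iter (enc c) (Seq ^~ (Inc (b + 0))) (clear (b + 0)))).
move=> v a; apply: ExSeq; first exact: st_clear.
move: (enc c); elim=> [|n IH] /=; first exact: st_clear.
by apply: ExSeq; [exact: IH | exact: st_inc].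
Qed.

Lemma rec_S (f : A -> nat) : rec f -> rec (fun a => (f a).+1).
Proof.
move=> rf b; have [p pf] := rf b.
by exists (Seq p (Inc (b + 0))) => v a; apply: ExSeq; [exact: pf | exact: st_inc].
Qed.

Lemma rec_pred (f : A -> nat) : rec f -> rec (fun a => (f a).-1).
Proof.
move=> rf b; have [p pf] := rf b.
by exists (Seq p (Dec (b + 0))) => v a; apply: ExSeq; [exact: pf | exact: st_dec].
Qed.

(** Unbounded search without partial functions: the values of [f] are given beforehand, and the
    hypothesis says that the loop stops with them. *)
Lemma rec_while (y : A -> C) (t : C -> nat) (g : C -> C) (f : A -> C) :
  rec y -> rec t -> rec g ->
  (forall a, exists k, [/\ f a = iter k g (y a), t (f a) = 0 &
     forall j, j < k -> 0 < t (iter j g (y a))]) -> rec f.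
Proof.
move=> ry rt rg fP b.
have [py pyP] := ry b; have [pg pgP] := rg b; have [pt ptP] := rt b.+1.
pose test := Seq (dup b) pt.
have run_test v c : exec test (st v b [:: enc c]) (st v b [:: enc c; t c]).
  apply: ExSeq; first exact: st_dup.
  by rewrite !(st_cons _ _ _ [:: _]); apply: ptP.
pose loop := While (b + 1) (Seq (clear (b + 1)) (Seq pg test)).
exists (Seq py (Seq test loop)) => v a.
apply: ExSeq; first exact: pyP.
apply: ExSeq; first exact: run_test.
have [k [fa tk tj]] := fP a; rewrite fa in tk *; move: (y a) tk tj => c {fa}.
elim: k c => [|k IH] c tk tj.
  by apply: (exec_eq (ExWhileF _ _)); rewrite ?st_nth //= tk (st_rcons0 _ _ [:: _]).
rewrite iterSr; apply: ExWhileT; first by rewrite st_nth; apply: (tj 0).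
  apply: ExSeq; first exact: st_clear.
  rewrite /= (st_rcons0 _ _ [:: _]).
  by apply: ExSeq; [exact: pgP | exact: run_test].
by apply: IH => [|j lt_j]; rewrite -iterSr //; apply: tj.
Qed.

End RecClosure.

Lemma rec_id A {eA : encodable A} : rec (@id A).
Proof. exact: rec_cast. Qed.

(** A loop on the argument, a counter running down and the current value; [final] is the whole
    triple, since [rec_while] returns the loop state. *)
Lemma rec_iter A C {eA : encodable A} {eC : encodable C}
    (n : A -> nat) (y : A -> C) (h : A * C -> C) :
  rec n -> rec y -> rec h ->
  rec (fun a => iter (n a) (fun c => h (a, c)) (y a)).
Proof.
move=> rn ry rh.
pose g (s : A * (nat * C)) := (s.1, (s.2.1.-1, h (s.1, s.2.2))).
pose final a := (a, (0, iter (n a) (fun c => h (a, c)) (y a))).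
suff rf : rec (eA := eA) (eB := prod_enc eA (prod_enc nat_enc eC)) final.
  exact: (rec_snd (rec_snd rf)).
apply: (@rec_while _ _ _ _ (fun a => (a, (n a, y a))) (fun s => s.2.1) g).
- by apply: rec_pair; [exact: rec_id | exact: rec_pair].
- by apply: rec_fst; apply: rec_snd; exact: rec_id.
- apply: rec_pair; first by apply: rec_fst; exact: rec_id.
  apply: rec_pair; first by apply: rec_pred; apply: rec_fst; apply: rec_snd; exact: rec_id.
  apply: (rec_comp _ rh).
  apply: rec_pair; first by apply: rec_fst; exact: rec_id.
  by apply: rec_snd; apply: rec_snd; exact: rec_id.
- move=> a; exists (n a).
  have itg j : iter j g (a, (n a, y a)) = (a, (n a - j, iter j (fun c => h (a, c)) (y a))).
    by elim: j => [|j IH] /=; rewrite ?subn0 // IH /g /= subnS.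
  by rewrite itg subnn; split=> // j; rewrite itg subn_gt0.
Qed.


Lemma rec_if A B {eA : encodable A} {eB : encodable B}
    (c : A -> bool) (f g : A -> B) :
  rec c -> rec f -> rec g -> rec (fun a => if c a then f a else g a).
Proof.
move=> rc rf rg.
apply: (@rec_ext _ _ _ _ (fun a => iter (c a) (fun _ => f a) (g a))).
  by move=> a; case: (c a).
apply: (@rec_iter _ _ _ _ (fun a => nat_of_bool (c a)) g (fun p => f p.1)) => //.
by apply: (rec_comp _ rf); apply: rec_fst; exact: rec_id.
Qed.

Lemma rec_op A B C D {eA : encodable A} {eB : encodable B} {eC : encodable C} {eD : encodable D}
    (op : B -> C -> D) (f : A -> B) (g : A -> C) :
  rec (fun p : B * C => op p.1 p.2) -> rec f -> rec g -> rec (fun a => op (f a) (g a)).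
Proof. by move=> r rf rg; exact: (rec_comp (rec_pair rf rg) r). Qed.

Lemma rec_app A B C {eA : encodable A} {eB : encodable B} {eC : encodable C} (g : B -> C) (f : A -> B) :
  rec g -> rec f -> rec (fun a => g (f a)).
Proof. by move=> rg rf; exact: (rec_comp rf rg). Qed.

(** * Automation, and arithmetic on natural numbers *)

Ltac rec_step tac := lazymatch goal with
  | |- @rec _ _ _ _ (fun _ => ?c) => exact: rec_cst
  | |- @rec _ _ _ _ (fun a => a) => exact: rec_id
  | |- @rec _ _ _ _ fst => exact: (rec_fst (@rec_id _ _))
  | |- @rec _ _ _ _ snd => exact: (rec_snd (@rec_id _ _))
  | |- @rec _ _ _ _ S => exact: (rec_S (@rec_id _ _))
  | |- @rec _ _ _ _ (fun a => fst (@?f a)) => refine (@rec_fst _ _ _ _ _ _ f _)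
  | |- @rec _ _ _ _ (fun a => snd (@?f a)) => refine (@rec_snd _ _ _ _ _ _ f _)
  | |- @rec _ _ _ _ (fun a => (@?f a, @?g a)) => refine (@rec_pair _ _ _ _ _ _ f g _ _)
  | |- @rec _ _ _ _ (fun a => S (@?f a)) => refine (@rec_S _ _ f _)
  | |- @rec _ _ _ _ (fun a => predn (@?f a)) => refine (@rec_pred _ _ f _)
  | _ => first [apply: rec_if | tac tt]
  end.

Ltac rec_fail _ := fail.

Lemma rec_addn : rec (fun p : nat * nat => p.1 + p.2).
Proof.
apply: (@rec_ext _ _ _ _ (fun p => iter p.2 S p.1)).
  by move=> a; rewrite iter_succn.
by apply: (rec_iter (h := fun p => p.2.+1)); repeat rec_step rec_fail.
Qed.

Lemma rec_subn : rec (fun p : nat * nat => p.1 - p.2).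
Proof.
apply: (@rec_ext _ _ _ _ (fun p => iter p.2 predn p.1)).
  by case=> x y /=; elim: y => [|m IH] /=; rewrite ?subn0 // IH subnS.
by apply: (rec_iter (h := fun p => p.2.-1)); repeat rec_step rec_fail.
Qed.

Lemma rec_muln : rec (fun p : nat * nat => p.1 * p.2).
Proof.
apply: (@rec_ext _ _ _ _ (fun p => iter p.2 (fun c => c + p.1) 0)).
  by case=> x y /=; elim: y => [|m IH] /=; rewrite ?muln0 // IH mulnS addnC.
apply: (rec_iter (h := fun p => p.2 + p.1.1)); repeat rec_step rec_fail.
by apply: (rec_op rec_addn); repeat rec_step rec_fail.
Qed.

Lemma rec_expn : rec (fun p : nat * nat => p.1 ^ p.2).
Proof.
apply: (@rec_ext _ _ _ _ (fun p => iter p.2 (fun c => p.1 * c) 1)).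
  by case=> x y /=; elim: y => [|m IH] //=; rewrite IH expnS.
apply: (rec_iter (h := fun p => p.1.1 * p.2)); repeat rec_step rec_fail.
by apply: (rec_op rec_muln); repeat rec_step rec_fail.
Qed.

Lemma rec_odd : rec odd.
Proof.
apply: (@rec_ext _ _ _ _ (fun n => iter n (fun b => if b then false else true) false)).
  by elim=> [|n IH] //=; rewrite IH; case: odd.
apply: (rec_iter (n := fun n => n) (h := fun p => if p.2 then false else true));
  by repeat rec_step rec_fail.
Qed.

Lemma rec_leqn : rec (fun p : nat * nat => p.1 <= p.2).
Proof.
apply: (@rec_ext _ _ _ _ (fun p => iter (p.1 - p.2) (fun _ => false) true)).
  by case=> x y /=; rewrite leqNgt -subn_gt0; case: (x - y).
by apply: (rec_iter (h := fun _ => false)); [exact: rec_subn | exact: rec_cst | exact: rec_cst].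
Qed.

Lemma rec_eqn : rec (fun p : nat * nat => p.1 == p.2).
Proof.
apply: (@rec_ext _ _ _ _ (fun p => if p.1 <= p.2 then p.2 <= p.1 else false)).
  by case=> x y /=; rewrite eqn_leq.
apply: rec_if; [exact: rec_leqn | | exact: rec_cst].
by apply: (rec_op rec_leqn); repeat rec_step rec_fail.
Qed.

Ltac rec_arith tac := lazymatch goal with
  | |- @rec _ _ _ _ (fun a => @?f a + @?g a) => refine (@rec_op _ _ _ _ _ _ _ _ addn f g rec_addn _ _)
  | |- @rec _ _ _ _ (fun a => @?f a - @?g a) => refine (@rec_op _ _ _ _ _ _ _ _ subn f g rec_subn _ _)
  | |- @rec _ _ _ _ (fun a => @?f a * @?g a) => refine (@rec_op _ _ _ _ _ _ _ _ muln f g rec_muln _ _)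
  | |- @rec _ _ _ _ (fun a => @?f a ^ @?g a) => refine (@rec_op _ _ _ _ _ _ _ _ expn f g rec_expn _ _)
  | |- @rec _ _ _ _ (fun a => @?f a <= @?g a) => refine (@rec_op _ _ _ _ _ _ _ _ leq f g rec_leqn _ _)
  | |- @rec _ _ _ _ (fun a => @?f a == @?g a) => refine (@rec_op _ _ _ _ _ _ _ _ (@eq_op nat) f g rec_eqn _ _)
  | |- @rec _ _ _ _ (fun a => odd (@?f a)) => refine (@rec_app _ _ _ _ _ _ odd f rec_odd _)
  | _ => rec_step tac
  end.

(* The inner test makes the quotient by 0 equal to 0. *)
Lemma rec_divn : rec (fun p : nat * nat => p.1 %/ p.2).
Proof.
apply: (@rec_ext _ _ _ _
  (fun p => iter p.1 (fun c => if c.+1 * p.2 <= p.1 then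
                               if 1 <= p.2 then c.+1 else c else c) 0)).
  case=> x [|y] /=; first by rewrite divn0; elim: {1}x => //= n ->.
  suff it n : iter n (fun c => if c.+1 * y.+1 <= x then c.+1 else c) 0
              = minn n (x %/ y.+1).
    by rewrite it; apply/minn_idPr; exact: leq_div.
  elim: n => [|n IH]; first by rewrite min0n.
  by rewrite iterS IH -leq_divRL //; case: ifP; lia.
apply: (rec_iter (h := fun q => if q.2.+1 * q.1.2 <= q.1.1 then
                                if 1 <= q.1.2 then q.2.+1 else q.2 else q.2));
  by repeat rec_arith rec_fail.
Qed.

Lemma rec_modn : rec (fun p : nat * nat => p.1 %% p.2).
Proof.
apply: (@rec_ext _ _ _ _ (fun p => p.1 - p.1 %/ p.2 * p.2)).
  by case=> x y /=; rewrite {1}(divn_eq x y) addKn.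
apply: (rec_op rec_subn); first by repeat rec_step rec_fail.
by apply: (rec_op rec_muln); [exact: rec_divn | repeat rec_step rec_fail].
Qed.

Ltac rec_auto := repeat lazymatch goal with
  | |- @rec _ _ _ _ (fun a => @?f a %/ @?g a) => refine (@rec_op _ _ _ _ _ _ _ _ divn f g rec_divn _ _)
  | |- @rec _ _ _ _ (fun a => @?f a %% @?g a) => refine (@rec_op _ _ _ _ _ _ _ _ modn f g rec_modn _ _)
  | _ => rec_arith ltac:(fun _ => match goal with
    | H : @rec _ _ _ _ ?g |- @rec _ _ _ _ ?g => exact: H
    | H : @rec _ _ _ _ ?g |- @rec _ _ _ _ (fun a => ?g (@?f a)) =>
        refine (@rec_app _ _ _ _ _ _ g f H _)
    end)
  end.

(** A nested conditional over the enumeration of [T]; it supplies the transition tables of Turing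
    machines and the table of stakes. *)
Lemma rec_finite (T : finType) (c : T -> nat) (f : T -> nat) : injective c ->
  exists2 g : nat -> nat, rec g & forall x, g (c x) = f x.
Proof.
move=> c_inj; pose g s n := foldr (fun x r => if n == c x then f x else r) 0 s.
exists (g (enum T)) => [|x].
  by elim: (enum T) => [|x s IH]; rewrite /g /=; rec_auto.
have: x \in enum T by rewrite mem_enum.
elim: (enum T) => //= y s IH; rewrite inE.
case: (c x =P c y) => [e|ne /orP[/eqP xy|]]; last exact: IH.
  by rewrite (c_inj _ _ e).
by rewrite xy in ne.
Qed.

Lemma recursive_of_rec (f : nat -> nat) : rec f -> recursive f.
Proof.
move=> /(_ 0) [p pf]; apply: (@recursive_of_prog p) => n.
have one m : one_reg m = st (fun=> 0) 0 [:: m].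
  by apply: funext => -[|[]].
by rewrite !one; apply: pf.
Qed.

(** * Simulation of Turing machines by register programs *)

Section Digits.

Variable K : nat.
Hypothesis K_gt0 : 0 < K.

Definition digit n i := n %/ K ^ i %% K.

Definition set_digit n i s := (n %/ K ^ i.+1 * K + s) * K ^ i + n %% K ^ i.

Lemma digit0 i : digit 0 i = 0.
Proof. by rewrite /digit div0n mod0n. Qed.

Lemma digit_shift n s i : s < K ->
  digit (n * K + s) i = if i is j.+1 then digit n j else s.
Proof.
case: i => [|i] sK; first by rewrite /digit divn1 modnMDl modn_small.
by rewrite /digit expnS divnMA divnMDl // (divn_small sK) // addn0.
Qed.

Lemma digit_low a r i j : i < j -> digit (a * K ^ j + r) i = digit r i.
Proof.
move=> ij; have -> : K ^ j = K ^ (j - i.+1) * K * K ^ i.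
  by rewrite -expnSr -expnD; congr (K ^ _); lia.
by rewrite /digit mulnA divnMDl ?expn_gt0 ?K_gt0 // mulnA modnMDl.
Qed.

Lemma digit_set n i s j : s < K ->
  digit (set_digit n i s) j = if j == i then s else digit n j.
Proof.
move=> sK; rewrite /set_digit; have Ki : 0 < K ^ i by rewrite expn_gt0 K_gt0.
case: ltngtP => ij.
- by rewrite digit_low // [in RHS](divn_eq n (K ^ i)) digit_low.
- have ej : K ^ j = K ^ i.+1 * K ^ (j - i.+1) by rewrite -expnD subnKC.
  rewrite /digit ej !divnMA; congr (_ %/ _ %% _).
  move: (n %/ K ^ i.+1) => h; rewrite expnSr divnMA divnMDl //.
  by rewrite (divn_small (ltn_pmod _ Ki)) addn0 divnMDl // (divn_small sK) addn0.
- rewrite ij /digit divnMDl // (divn_small (ltn_pmod _ Ki)) addn0.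
  by rewrite modnMDl modn_small.
Qed.

End Digits.

Section Simulation.

Variable M : turing_machine.

Let K := #|tm_symbol M|.+1.

(* A tape is coded in base [K]; blanks must be 0 for the code to be finite. *)
Let sym_code (a : tm_symbol M) : nat :=
  if a == tm_blank M then 0 else (enum_rank a).+1.

Let state_code (q : tm_state M) : nat := enum_rank q.

Lemma sym_code_lt a : sym_code a < K.
Proof. by rewrite /sym_code; case: ifP => // _; rewrite ltnS. Qed.

Lemma sym_code_inj : injective sym_code.
Proof.
move=> a b; rewrite /sym_code; case: eqP => [->|_]; case: eqP => // _ [] e.
by apply: enum_rank_inj; apply: val_inj.
Qed.

Let key (x : tm_state M * tm_symbol M) := Cantor.to_nat (state_code x.1, sym_code x.2).

Lemma key_inj : injective key.
Proof.
move=> [q a] [q' a'] /Cantor.to_nat_inj [e /sym_code_inj ->].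
by congr pair; apply: enum_rank_inj; apply: val_inj.
Qed.

Variables (running next_state written shift : nat -> nat).

Let delta (x : tm_state M * tm_symbol M) := tm_delta x.1 x.2.

Hypothesis runningP : forall x, running (key x) = isSome (delta x).
Hypothesis nextP : forall x, next_state (key x) =
  if delta x is Some (q, _, _) then state_code q else 0.
Hypothesis writtenP : forall x, written (key x) =
  if delta x is Some (_, a, _) then sym_code a else 0.
Hypothesis shiftP : forall x, shift (key x) =
  if delta x is Some (_, _, m) then
    match m with MoveLeft => 0 | Stay => 1 | MoveRight => 2 end else 0.

Definition scanned (c : nat * (nat * nat)) :=
  Cantor.to_nat (c.1, digit K c.2.2 c.2.1).

(** The shifts 0, 1, 2 followed by a predecessor render the three moves; truncation keeps the head
    on cell 0, as in [tm_move_head]. *)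
Definition sim_step (c : nat * (nat * nat)) :=
  (next_state (scanned c),
   ((c.2.1 + shift (scanned c)).-1, set_digit K c.2.2 c.2.1 (written (scanned c)))).

Definition sim (c : nat * (nat * nat)) (cfg : tm_config M) :=
  [/\ c.1 = state_code (tm_cur cfg), c.2.1 = tm_head cfg
    & forall i, digit K c.2.2 i = sym_code (tm_tape cfg i)].

Lemma sim_scanned c cfg : sim c cfg ->
  scanned c = key (tm_cur cfg, tm_tape cfg (tm_head cfg)).
Proof. by case=> ec eh et; rewrite /scanned ec eh et. Qed.

Lemma sim_stepP c cfg cfg' : sim c cfg -> tm_step cfg = Some cfg' ->
  sim (sim_step c) cfg'.
Proof.
move=> sc; have ek := sim_scanned sc; case: sc => ec eh et.
rewrite /tm_step /sim_step ek nextP writtenP shiftP /delta /=.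
case: tm_delta => [[[q a] m]|//] [<-]; split=> //=.
  by rewrite eh; case: m => /=; lia.
move=> i; rewrite digit_set ?sym_code_lt // eh.
by case: eqP.
Qed.

Lemma sim_run k c cfg cfg' : sim c cfg ->
  iter k (obind (@tm_step M)) (Some cfg) = Some cfg' ->
  sim (iter k sim_step c) cfg' /\
  forall j, j < k -> 0 < running (scanned (iter j sim_step c)).
Proof.
elim: k c cfg => [|k IH] c cfg sc; first by case=> <-.
rewrite iterSr [obind _ _]/=; case e: (tm_step cfg) => [cfg1|]; last first.
  have none m : iter m (obind (@tm_step M)) None = None by elim: m => //= m ->.
  by rewrite none.
move=> /(IH _ _ (sim_stepP sc e)) [s run]; rewrite iterSr; split=> // -[|j] lt_j.
  rewrite (sim_scanned sc) runningP /delta /=.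
  by move: e; rewrite /tm_step; case: tm_delta.
by rewrite iterSr; apply: run.
Qed.

Lemma sim_halt c cfg : sim c cfg -> tm_step cfg = None -> running (scanned c) = 0.
Proof.
move=> /sim_scanned ->; rewrite runningP /delta /tm_step /=.
by case: tm_delta => [[[]]|].
Qed.

Definition init_code n := iter n (fun c => c * K + sym_code (tm_mark M)) 0.

Lemma sim_init n : sim (state_code (tm_start M), (0, init_code n)) (tm_init M n).
Proof.
split=> //= i; elim: n i => [|n IH] i /=.
  by rewrite digit0 /sym_code eqxx.
rewrite digit_shift ?sym_code_lt //; case: i => [//|i].
by rewrite IH ltnS.
Qed.

Hypotheses (rec_running : rec running) (rec_next : rec next_state).
Hypotheses (rec_written : rec written) (rec_shift : rec shift).

Lemma rec_digit : rec (fun p : nat * nat => digit K p.1 p.2).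
Proof. by rewrite /digit; rec_auto. Qed.

Lemma rec_set_digit : rec (fun p : nat * (nat * nat) => set_digit K p.1 p.2.1 p.2.2).
Proof. by rewrite /set_digit; rec_auto. Qed.

Lemma rec_scanned : rec scanned.
Proof.
have rd := rec_digit.
apply: (@rec_recode _ _ _ _ _ _ (fun c => (c.1, digit K c.2.2 c.2.1))) => //.
apply: rec_pair; first by rec_auto.
by apply: (rec_op rd); rec_auto.
Qed.

Lemma rec_sim_step : rec sim_step.
Proof.
have rs := rec_scanned; have rd := rec_set_digit.
apply: rec_pair; first by rec_auto.
apply: rec_pair; first by rec_auto.
apply: (rec_op (op := fun x p => set_digit K x p.1 p.2) (g := fun c => (c.2.1, written (scanned c)))) => //;
  by rec_auto.
Qed.

Lemma rec_init_code : rec init_code.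
Proof. by apply: (rec_iter (n := id) (h := fun p => p.2 * K + sym_code (tm_mark M))); rec_auto. Qed.

Lemma rec_of_simulation f : tm_computes M f -> rec f.
Proof.
move=> Mf; have [F FP] : exists F, forall n, exists k cfg,
    [/\ F n = iter k sim_step (state_code (tm_start M), (0, init_code n)),
        sim (F n) cfg, running (scanned (F n)) = 0, tm_output cfg (f n) &
        forall j, j < k -> 0 < running
          (scanned (iter j sim_step (state_code (tm_start M), (0, init_code n))))].
  suff /choice [F FP] : forall n, exists c, exists k cfg,
    [/\ c = iter k sim_step (state_code (tm_start M), (0, init_code n)),
        sim c cfg, running (scanned c) = 0, tm_output cfg (f n) &
        forall j, j < k -> 0 < running
          (scanned (iter j sim_step (state_code (tm_start M), (0, init_code n))))].
    by exists F.
  move=> n; have [k [cfg [run halt out]]] := Mf n.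
  have [s pos] := sim_run (sim_init n) run.
  by eexists; exists k, cfg; split=> //; apply: sim_halt halt.
have rs := rec_scanned; have rst := rec_sim_step; have ri := rec_init_code.
have rd := rec_digit.
have rF : rec F.
  apply: (rec_while (y := fun n => (state_code (tm_start M), (0, init_code n)))
    (t := fun c => running (scanned c)) (g := sim_step)); try by rec_auto.
  by move=> n; have [k [cfg [-> _ h _ pos]]] := FP n; exists k.
(* The output is read by a second loop that advances over the marks of the final tape. Marks and
   blanks have different codes, so it stops exactly at [f n]. *)
pose G n := ((F n).2.2, f n).
suff rG : rec (eA := nat_enc) (eB := prod_enc nat_enc nat_enc) G.
  exact: (rec_snd rG).
apply: (rec_while (y := fun n => ((F n).2.2, 0))
  (t := fun p => if digit K p.1 p.2 == sym_code (tm_mark M) then 1 else 0)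
  (g := fun p => (p.1, p.2.+1))).
- by rec_auto.
- apply: rec_if; [| by rec_auto | by rec_auto].
  by apply: (rec_op rec_eqn); [exact: rd | rec_auto].
- by rec_auto.
move=> n; exists (f n); have [k [cfg [_ [_ _ dig] _ [marks blank] _]]] := FP n.
have itg j x : iter j (fun p : nat * nat => (p.1, p.2.+1)) (x, 0) = (x, j).
  by elim: j => [|j IH] //=; rewrite IH.
split=> [|| j lt_j]; rewrite ?itg //=; last by rewrite dig marks // eqxx.
rewrite dig blank.
by rewrite (inj_eq sym_code_inj) eq_sym (negbTE (tm_mark_neq_blank M)).
Qed.

End Simulation.

Lemma rec_of_recursive f : recursive f -> rec f.
Proof.
case=> M Mf.
have [r rr rP] := rec_finite (fun x => isSome (tm_delta x.1 x.2)) (@key_inj M).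
have [q rq qP] := rec_finite (fun x => if tm_delta x.1 x.2 is Some (q, _, _)
  then enum_rank q : nat else 0) (@key_inj M).
have [w rw wP] := rec_finite (fun x => if tm_delta x.1 x.2 is Some (_, a, _)
  then if a == tm_blank M then 0 else (enum_rank a).+1 else 0) (@key_inj M).
have [s rs sP] := rec_finite (fun x => if tm_delta x.1 x.2 is Some (_, _, m) then
  match m with MoveLeft => 0 | Stay => 1 | MoveRight => 2 end else 0) (@key_inj M).
exact: (rec_of_simulation rP qP wP sP).
Qed.

(** * Enumeration of the recursive maps *)

Fixpoint prog_code p : nat :=
  match p with
  | Inc j => Cantor.to_nat (0, j)
  | Dec j => Cantor.to_nat (1, j)
  | Seq p q => Cantor.to_nat (2, Cantor.to_nat (prog_code p, prog_code q))
  | If j p q => Cantor.to_nat (3, Cantor.to_nat (j, Cantor.to_nat (prog_code p, prog_code q)))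
  | While j p => Cantor.to_nat (4, Cantor.to_nat (j, prog_code p))
  end.

Lemma to_nat_pair_inj a b c d :
  Cantor.to_nat (a, b) = Cantor.to_nat (c, d) -> a = c /\ b = d.
Proof. by move/Cantor.to_nat_inj; case. Qed.

Lemma prog_code_inj : injective prog_code.
Proof.
elim=> [j|j|p IHp q IHq|j p IHp q IHq|j p IHp] [j'|j'|p' q'|j' p' q'|j' p'];
  move=> /to_nat_pair_inj[] //.
- by move=> _ ->.
- by move=> _ ->.
- by move=> _ /to_nat_pair_inj[/IHp -> /IHq ->].
- by move=> _ /to_nat_pair_inj[-> /to_nat_pair_inj[/IHp -> /IHq ->]].
- by move=> _ /to_nat_pair_inj[-> /IHp ->].
Qed.

(** A code determines its program and the program its function, so each [k] stands for at most one
    map. [F] comes from choice, with [id] as default where [k] codes no program for a total map. *)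
Lemma recursive_enumeration :
  exists F : nat -> nat -> nat, forall f, recursive f -> exists k, F k = f.
Proof.
pose P k f := exists2 p, prog_code p = k &
  forall n, exec p (st (fun=> 0) 0 [:: n]) (st (fun=> 0) 0 [:: f n]).
have [F FP] : exists F, forall k f, P k f -> F k = f.
  suff /choice [F FP] : forall k, exists g, forall f, P k f -> g = f by exists F.
  move=> k; case: (pselect (exists g, P k g)) => [[g [p ek gP]]|nP]; last first.
    by exists id => f Pf; case: nP; exists f.
  exists g => f [q eq fP]; rewrite -ek in eq; rewrite (prog_code_inj eq) in fP.
  apply: funext => n; have /(congr1 (@^~ 0)) := exec_det (gP n) (fP n).
  by rewrite /st /=.
exists F => f /rec_of_recursive /(_ 0) [p pf].
by exists (prog_code p); apply: FP; exists p => // n; apply: pf.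
Qed.

Import Order.TTheory GRing.Theory Num.Theory.

(** * Computable functions of situations *)

Lemma recursive_snE (f : situation -> nat -> nat) :
  recursive_sn f <-> rec (fun p : situation * nat => f p.1 p.2).
Proof.
split=> [[g /rec_of_recursive rg gf]|rf].
  apply: (@rec_ext _ _ _ _ (fun p => g (sncode p))) => [[s n]|]; first exact: gf.
  by apply: (rec_app rg); apply: rec_cast.
have [d dK Kd] := sncode_bij.
exists (fun n => f (d n).1 (d n).2) => [|s n]; last by rewrite dK.
apply: recursive_of_rec => b; have [p pP] := rf b; exists p => v n.
by rewrite -[in X in exec _ X _](Kd n); apply: pP.
Qed.

Lemma rec_scode : rec scode.
Proof. exact: rec_cast. Qed.

Lemma rec_of_scode B {eB : encodable B} (h : nat -> nat) (f : situation -> B) :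
  rec h -> (forall s, enc (f s) = h (scode s)) -> rec f.
Proof. by move=> rh e; apply: (rec_recode e); apply: (rec_app rh); exact: rec_scode. Qed.

Lemma scode_rcons s x : scode (rcons s x) = ((scode s).*2.+1 + x)%N.
Proof. by rewrite /scode foldl_rcons. Qed.

Definition parent (s : situation) : situation := take (size s).-1 s.

Lemma parent_rcons s x : parent (rcons s x) = s.
Proof. by rewrite /parent size_rcons /= -cats1 take_size_cat. Qed.

(** A non-zero code minus one is twice the code of the parent plus the last digit; its half is used
    here, its parity in [rec_last]. *)
Lemma rec_parent : rec parent.
Proof.
apply: (@rec_of_scode _ _ (fun n => n.-1 %/ 2)); first by rec_auto.
move=> s; case/lastP: s => [//|s x]; rewrite parent_rcons scode_rcons /=.
by rewrite /enc /situation_enc; case: x; lia.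
Qed.

Lemma rec_last : rec (last false).
Proof.
have ro := rec_odd.
apply: (@rec_of_scode _ _ (fun n => odd n.-1)).
  by apply: (@rec_recode _ _ _ _ _ _ (fun n => odd n.-1)) => //; rec_auto.
move=> s; case/lastP: s => [//|s x]; rewrite last_rcons scode_rcons /=.
by rewrite oddD odd_double; case: x.
Qed.

(** The loop strips digits from the end of the string, so values accumulate from the last digit to
    the first; hence [F] takes the accumulator as an argument. *)
Lemma rec_prefix_fold C {eC : encodable C} (h : situation -> bool -> C -> C)
    (F : situation -> C -> C) c0 :
  (forall c, F [::] c = c) -> (forall s x c, F (rcons s x) c = F s (h s x c)) ->
  rec (fun q : situation * bool * C => h q.1.1 q.1.2 q.2) -> rec (F ^~ c0).
Proof.
move=> F0 F1 rh; have rp := rec_parent; have rl := rec_last; have rs := rec_scode.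
pose g (q : situation * C) := (parent q.1, h (parent q.1) (last false q.1) q.2).
pose G s := ([::] : situation, F s c0).
suff rG : rec (eA := situation_enc) (eB := prod_enc situation_enc eC) G.
  exact: (rec_snd rG).
apply: (rec_while (y := fun s => (s, c0)) (t := fun q => scode q.1) (g := g)).
- by rec_auto.
- by rec_auto.
- apply: rec_pair; first by rec_auto.
  apply: (rec_app (f := fun q => (parent q.1, last false q.1, q.2)) rh).
  by rec_auto.
move=> s; exists (size s); rewrite /G; elim/last_ind: s (c0) => [|s x IH] c.
  by rewrite F0.
rewrite F1 size_rcons iterSr.
have gx : g (rcons s x, c) = (s, h s x c) by rewrite /g /= parent_rcons last_rcons.
rewrite gx; have [-> -> pos] := IH (h s x c); split=> // -[|j] lt_j.
  by rewrite /= scode_rcons.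
by rewrite iterSr gx; apply: pos.
Qed.

Lemma rec_size : rec (size : situation -> nat).
Proof.
apply: (@rec_ext _ _ _ _ (fun s => 0 + size s)) => //.
apply: (@rec_prefix_fold _ _ (fun _ _ c => c.+1) (fun s c => c + size s) 0).
- by move=> c; rewrite addn0.
- by move=> s x c; rewrite size_rcons addnS.
- by rec_auto.
Qed.

Definition path_prod (stake : situation -> bool -> nat) (s : situation) :=
  \prod_(i < size s) stake (take i s) (nth false s i).

Lemma path_prod_rcons stake s x :
  path_prod stake (rcons s x) = path_prod stake s * stake s x.
Proof.
rewrite /path_prod size_rcons big_ord_recr /= nth_rcons ltnn eqxx.
rewrite -cats1 take_size_cat //; congr muln; apply: eq_bigr => i _.
by rewrite nth_cat ltn_ord takel_cat // ltnW.
Qed.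

Lemma rec_path_prod stake :
  rec (fun p : situation * bool => stake p.1 p.2) -> rec (path_prod stake).
Proof.
move=> rs; apply: (@rec_ext _ _ _ _ (fun s => 1 * path_prod stake s)).
  by move=> s; rewrite mul1n.
apply: (@rec_prefix_fold _ _ (fun s x c => c * stake s x) (fun s c => c * path_prod stake s) 1).
- by move=> c; rewrite /path_prod big_ord0 muln1.
- by move=> s x c; rewrite path_prod_rcons mulnAC mulnA.
- apply: (rec_op rec_muln); first by rec_auto.
  by apply: (rec_app (f := fun q : situation * bool * nat => q.1) rs); rec_auto.
Qed.

(** * Levels of a given rank *)

Definition rank (n : nat) := (Cantor.of_nat n).1.

Lemma rec_rank : rec rank.
Proof.
apply: rec_fst; apply: rec_cast => n; rewrite -[RHS]Cantor.cancel_to_of.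
by case: Cantor.of_nat.
Qed.

Definition visits k n := \sum_(i < n) (rank i == k).

Lemma visitsS k n : visits k n.+1 = visits k n + (rank n == k).
Proof. by rewrite /visits big_ord_recr. Qed.

Lemma leq_visits k m n : (m <= n)%N -> (visits k m <= visits k n)%N.
Proof.
elim: n => [|n IH]; first by case: m.
rewrite leq_eqVlt => /orP[/eqP -> //|/IH le_mn].
by rewrite visitsS (leq_trans le_mn) // leq_addr.
Qed.

(** The level [Cantor.to_nat (k, n)] has rank [k] and is at least [n], so there is always a further
    visit. This count is the growth function that the betting capital will overtake. *)
Lemma growth_visits k : growth_function (visits k).
Proof.
split; last 2 first.
- exact: leq_visits.
- elim=> [|B [n lt_Bn]].
    by exists (Cantor.to_nat (k, 0)).+1; rewrite visitsS /rank Cantor.cancel_of_to eqxx addn1.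
  exists (Cantor.to_nat (k, n)).+1.
  rewrite visitsS /rank Cantor.cancel_of_to eqxx addn1 ltnS (leq_trans lt_Bn) //.
  apply: leq_visits; apply/ssrnat.leP.
  apply: PeanoNat.Nat.le_trans (Cantor.to_nat_non_decreasing k n).
  exact: PeanoNat.Nat.le_add_r.
- apply: recursive_of_rec; have rr := rec_rank.
  apply: (@rec_ext _ _ _ _ (fun n => (iter n (fun q => (q.1.+1,
      if rank q.1 == k then q.2.+1 else q.2)) (0, 0)).2)).
    move=> n; suff -> : iter n (fun q => (q.1.+1,
      if rank q.1 == k then q.2.+1 else q.2)) (0, 0) = (n, visits k n) by [].
    elim: n => [|n IH]; first by rewrite /visits big_ord0.
    by rewrite iterS IH visitsS /=; case: eqP; rewrite ?addn1 ?addn0.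
  apply: rec_snd.
  by apply: (rec_iter (n := id) (h := fun p : nat * (nat * nat) => (p.2.1.+1,
      if rank p.2.1 == k then p.2.2.+1 else p.2.2))); rec_auto.
Qed.

Lemma rec_situation_bool_enumeration :
  exists F : nat -> situation -> bool, forall b, rec b -> exists k, F k = b.
Proof.
have [F FP] := recursive_enumeration; have [d dK Kd] := scode_bij.
exists (fun k s => F k (scode s) != 0) => b rb.
have [|k ek] := FP (fun n => b (d n)).
  apply: recursive_of_rec => r; have [p pP] := rb r; exists p => v n.
  by rewrite -[in X in exec _ X _](Kd n); apply: pP.
by exists k; apply: funext => s; rewrite ek dK; case: (b s).
Qed.

(** * Rational approximation of real processes *)

Section Approximations.

Variable R : realType.

Local Open Scope ring_scope.

Lemma ratr_signed_ratio (sg a b : nat) :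
  ratr ((-1) ^+ sg * a%:R / b%:R) = (-1) ^+ sg * a%:R / b%:R :> R.
Proof. by rewrite fmorph_div rmorphM rmorphXn rmorphN1 !rmorph_nat. Qed.

Lemma computable_ratio (F : real_process R) (num den : situation -> nat) :
  rec num -> rec den -> (forall s, den s != 0%N) ->
  (forall s, F s = (num s)%:R / (den s)%:R) -> computable_process F.
Proof.
move=> rn rd d0 FE; exists (fun s _ => (-1) ^+ 0 * (num s)%:R / (den s)%:R), (fun _ _ => 0%N).
split.
- exists (fun _ _ => 0%N), (fun s _ => num s), (fun s _ => den s).
  by split=> //; apply/recursive_snE; rec_auto.
- by apply/recursive_snE; rec_auto.
- by move=> s N n _; rewrite ratr_signed_ratio expr0 mul1r FE subrr normr0 invr_ge0 exprn_ge0.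
Qed.

Lemma computable_half (T : real_process R) : (forall s, 0 <= T s) ->
  computable_process T -> computable_process (fun s => (1 + T s) / 2).
Proof.
move=> T0 [r [e [[sg [a [b [/recursive_snE rsg /recursive_snE ra /recursive_snE rb b0 rE]]]]]]].
move=> re rT; have ro := rec_odd.
(* An approximation with negative sign is replaced by 0, which keeps the numerator natural. As [T]
   is non-negative this does not increase the error, so the modulus [e] still serves. *)
pose num s n := (if odd (sg s n) then b s n else a s n + b s n)%N.
pose den s n := (2 * b s n)%N.
exists (fun s n => (-1) ^+ 0 * (num s n)%:R / (den s n)%:R), e; split=> //.
  exists (fun _ _ => 0%N), num, den; split=> //.
  - by apply/recursive_snE; rec_auto.
  - apply/recursive_snE; rewrite /num; rec_auto.
  - by apply/recursive_snE; rewrite /den; rec_auto.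
  - by move=> s n; rewrite /den muln_eq0 negb_or b0.
move=> s N n le_en; have := rT s N n le_en.
rewrite rE !ratr_signed_ratio expr0 mul1r /num /den natrM.
have b1 : (b s n)%:R != 0 :> R by rewrite pnatr_eq0.
have ab : 0 <= (a s n)%:R / (b s n)%:R :> R by rewrite divr_ge0.
rewrite -signr_odd; case: odd; rewrite ?expr1 ?expr0 ?mulN1r ?mul1r.
- have -> : (b s n)%:R / (2 * (b s n)%:R) = 1 / 2 :> R by field.
  rewrite mulNr !ler_norml; have := T0 s; lra.
- rewrite natrD.
  have -> : ((a s n)%:R + (b s n)%:R) / (2 * (b s n)%:R) =
    (1 + (a s n)%:R / (b s n)%:R) / 2 :> R by field.
  rewrite !ler_norml; lra.
Qed.

(** Exact comparison of reals is not decidable, but comparing [u / v] with one approximation of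
    [F s] is. The margin makes the two answers overlap, and in the overlap either is correct. *)
Lemma computable_threshold (F : real_process R) (u v N : nat) :
  computable_process F -> (0 < v)%N ->
  exists2 b : situation -> bool, rec b &
    forall s, if b s then F s <= u%:R / v%:R + 2%:R ^- N
              else u%:R / v%:R - 2%:R ^- N <= F s.
Proof.
move=> [r [e [[sg [a [d [/recursive_snE rsg /recursive_snE ra /recursive_snE rd d0 rE]]]]]]].
move=> /recursive_snE re rT v0; have ro := rec_odd.
exists (fun s => let n := e s N in if odd (sg s n) then true else (a s n * v <= u * d s n)%N).
  rewrite /=.
  pose q s := (s, e s N).
  have rq : rec q by apply: rec_pair; [exact: rec_id | apply: (rec_op re); rec_auto].
  apply: rec_if.
  - by apply: (rec_app ro); exact: (rec_comp rq rsg).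
  - exact: rec_cst.
  - apply: (rec_op rec_leqn); apply: (rec_op rec_muln); try exact: rec_cst.
      exact: (rec_comp rq ra).
    exact: (rec_comp rq rd).
move=> s /=; have := rT s N _ (leqnn _).
rewrite rE ratr_signed_ratio; move: (e s N) => n.
have d1 : 0 < (d s n)%:R :> R by rewrite ltr0n lt0n.
have v1 : 0 < v%:R :> R by rewrite ltr0n.
have ad : 0 <= (a s n)%:R / (d s n)%:R :> R by rewrite divr_ge0.
have uv : 0 <= u%:R / v%:R :> R by rewrite divr_ge0.
rewrite -signr_odd; case: odd; rewrite ?expr1 ?expr0 ?mulN1r ?mul1r ler_norml.
  by rewrite mulNr; lra.
have cmp : ((a s n * v <= u * d s n)%N : bool) = ((a s n)%:R / (d s n)%:R <= u%:R / v%:R :> R).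
  by rewrite ler_pdivrMr // mulrAC ler_pdivlMr // -!natrM ler_nat.
by rewrite cmp; case: ifP => [|/negbT]; rewrite -?ltNge; lra.
Qed.

End Approximations.

(** * Supermartingales *)

Local Open Scope classical_set_scope.
Local Open Scope ring_scope.

Section Forecasts.

Variable R : realType.
Implicit Types (phi : forecasting_system R) (M T : real_process R).

Lemma expectation_atE M s p :
  expectation_at (process_diff M s) p =
  p * M (rcons s true) + (1 - p) * M (rcons s false) - M s.
Proof. by rewrite /expectation_at /process_diff; ring. Qed.

Lemma supermartingaleP phi M : supermartingale phi M <->
  forall s p, ilo (phi s) <= p <= ihi (phi s) ->
    p * M (rcons s true) + (1 - p) * M (rcons s false) <= M s.
Proof.
split=> [sM s p lpu|sM s].
  rewrite -subr_le0 -expectation_atE; apply: le_trans (sM s).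
  apply: ub_le_sup; last by exists p; rewrite //= in_itv.
  (* [sup] is an upper bound only for sets that are bounded above; this bound holds for all [q] in
     the unit interval. *)
  exists (`|process_diff M s true| + `|process_diff M s false|) => _ [q + <-].
  rewrite /= in_itv /= => /andP[lq qu].
  have q0 : 0 <= q by exact: le_trans (ilo_ge0 _) lq.
  have q1 : q <= 1 by exact: le_trans qu (ihi_le1 _).
  have := ler_norm (process_diff M s true); have := ler_norm (process_diff M s false).
  have := normr_ge0 (process_diff M s true); have := normr_ge0 (process_diff M s false).
  rewrite /expectation_at; nra.
apply: ge_sup => [|_ [p + <-]].
  exists (expectation_at (process_diff M s) (ilo (phi s))), (ilo (phi s)) => //=.
  by rewrite in_itv /= lexx ilo_le_ihi.
by rewrite /= in_itv /= => /sM; rewrite expectation_atE subr_le0.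
Qed.

Definition fair (p : situation -> R) M := forall s,
  p s * M (rcons s true) + (1 - p s) * M (rcons s false) <= M s.

(** A weighted mean that is at most [x] cannot have both values above [x]. The weight [q = 0] is
    treated apart, as [y] then has no influence on the mean. *)
Lemma fair_step (q x y z : R) :
  0 <= q <= 1 -> q * y + (1 - q) * z <= x -> x < y -> z <= x.
Proof.
move=> /andP[q0 q1] le_x lt_x; rewrite leNgt; apply/negP => lt_z.
move: q0; rewrite le_eqVlt => /orP[/eqP q0|q0]; first by rewrite -q0 in le_x; lra.
have : 0 < q * (y - x) by rewrite mulr_gt0 ?subr_gt0.
have : 0 <= (1 - q) * (z - x) by rewrite mulr_ge0 ?subr_ge0 // ltW.
nra.
Qed.

(* The weight of [T n] is fixed at stage [n] only, small enough for its value
   there, and each digit is chosen so that the current mixture does not increase. *)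
Lemma bounded_path_seq (p : situation -> R) (T : nat -> real_process R) :
  (forall s, 0 <= p s <= 1) -> (forall j s, 0 <= T j s) -> (forall j, fair p (T j)) ->
  exists w, forall j, exists B, forall n, T j (prefix_of w n) <= B.
Proof.
move=> p01 T0 Tp.
pose weight n s : R := 2%:R ^- n.+1 / (1 + T n s).
have weight_gt0 n s : 0 < weight n s.
  by rewrite divr_gt0 ?invr_gt0 ?exprn_gt0 // ltr_pwDl.
pose mix n (c : situation * real_process R) t := c.2 t + weight n c.1 * T n t.
pose digit n (c : situation * real_process R) : bool :=
  mix n c (rcons c.1 true) <= mix n c c.1.
(* [st n] holds the situation reached and the mixture of the first [n] processes. *)
pose st := fix st n := if n is m.+1 then
  (rcons (st m).1 (digit m (st m)), mix m (st m)) else ([::], fun=> 0).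
pose w n := digit n (st n).
have stw n : (st n).1 = prefix_of w n.
  by elim: n => [//|n IH]; rewrite /prefix_of mkseqS -/(prefix_of w n) -IH.
have st_ge0 n t : 0 <= (st n).2 t.
  elim: n => [|n IH] /=; first exact: lexx.
  by rewrite addr_ge0 // mulr_ge0 // ltW.
have mix_fair n : fair p (mix n (st n)).
  have fT (c : real_process R) a i : fair p c -> 0 <= a ->
      fair p (fun t => c t + a * T i t).
    by move=> fc a0 s; have := fc s; have := Tp i s; have := p01 s; nra.
  have fst : fair p (st n).2.
    elim: n => [|n IH] /=; first by move=> s /=; rewrite !mulr0 addr0.
    by apply: fT => //; exact: ltW.
  by apply: fT => //; exact: ltW.
(* Stage [n] adds at most [2^-(n+1)], and the chosen digit does not raise the mixture, so the total
   stays below 1. *)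
have st_le n : (st n).2 (st n).1 <= 1 - 2%:R ^- n.
  elim: n => [|n IH]; first by rewrite expr0 invr1 subrr.
  have lemix : mix n (st n) (st n.+1).1 <= mix n (st n) (st n).1.
    rewrite [(st n.+1).1]/=; case E: (digit n (st n)); first exact: E.
    move: E; rewrite /digit => /negbT; rewrite -ltNge => lt1.
    exact: fair_step (p01 _) (mix_fair n _) lt1.
  apply: le_trans lemix _.
  have half : weight n (st n).1 * T n (st n).1 <= 2%:R ^- n.+1.
    rewrite /weight mulrAC -mulrA ler_piMr ?invr_ge0 ?exprn_ge0 //.
    by rewrite ler_pdivrMr ?ltr_pwDl // mul1r lerDr.
  have e2 : 2%:R ^- n = 2%:R ^- n.+1 + 2%:R ^- n.+1 :> R.
    by rewrite exprS invfM; field; rewrite expf_neq0.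
  by rewrite /mix; lra.
have le_st j n t : (j < n)%N -> weight j (st j).1 * T j t <= (st n).2 t.
  elim: n => [//|n IH]; rewrite ltnS leq_eqVlt => /orP[/eqP ->|/IH le_n] /=.
    by rewrite lerDr.
  by apply: le_trans le_n _; rewrite lerDl mulr_ge0 // ltW.
(* Beyond stage [j] the weighted [T j] is part of a mixture below 1; the sum covers the finitely
   many prefixes up to length [j]. *)
exists w => j; exists ((weight j (st j).1)^-1 + \sum_(i < j.+1) T j (prefix_of w i)) => n.
have [le_nj|lt_jn] := leqP n j.
  have lt_n : (n < j.+1)%N by [].
  rewrite (bigD1 (Ordinal lt_n)) //= addrCA lerDl addr_ge0 ?invr_ge0 ?sumr_ge0 //.
  exact: ltW.
apply: (@le_trans _ _ (weight j (st j).1)^-1); last by rewrite lerDl sumr_ge0.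
rewrite -[X in _ <= X]mul1r ler_pdivlMr // mulrC -stw.
apply: le_trans (le_st j n _ lt_jn) _; apply: le_trans (st_le n) _.
by rewrite gerBl invr_ge0 exprn_ge0.
Qed.

Lemma bounded_path (p : situation -> R) (C : set (real_process R)) :
  (forall s, 0 <= p s <= 1) -> countable C ->
  (forall T, C T -> forall s, 0 <= T s) -> (forall T, C T -> fair p T) ->
  exists w, forall T, C T -> exists B, forall n, T (prefix_of w n) <= B.
Proof.
move=> p01 /countable_injP[f f_inj] C0 Cp.
(* Indices outside the image of [C] under [f] get the constant process 1, which is non-negative and
   fair for every [p]. *)
pose T j := xget (fun=> 1 : R) [set t | C t /\ f t = j].
have TP j : T j = (fun=> 1) \/ C (T j).
  by rewrite /T; case: xgetP => [t _ []|]; [right | left].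
have [j s|j|w wP] := @bounded_path_seq p T p01.
- by case: (TP j) => [->|/C0].
- by case: (TP j) => [-> s|/Cp //]; rewrite !mulr1 addrC subrK.
exists w => t Ct; suff <- : T (f t) = t by exact: wP.
rewrite /T; case: xgetP => [u _ [Cu fu]|/(_ t)]; last by case.
by apply: f_inj; rewrite ?inE.
Qed.

End Forecasts.

(** * The betting strategy *)

Section Constants.

Variable R : realType.

Lemma limn_esup_le0 (u : nat -> R) N : (forall n, (N <= n)%N -> u n <= 0) ->
  (limn_esup (fun n => (u n)%:E) <= 0)%E.
Proof.
move=> uN; apply: (@le_trans _ _ (ereal_sup ((fun n => (u n)%:E) @` [set n | (N <= n)%N]))).
  by apply: ereal_inf_lbound; exists [set n | (N <= n)%N] => //; exists N.
by apply: ge_ereal_sup => _ [n /= le_Nn <-]; rewrite lee_fin uN.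
Qed.

Lemma limn_esup_ge1 (u : nat -> R) N : (forall n, (N <= n)%N -> 1 <= u n) ->
  (1 <= limn_esup (fun n => (u n)%:E))%E.
Proof.
move=> uN; apply: le_ereal_inf_tmp => _ [V [m _ mV] <-].
apply: (@le_trans _ _ (u (maxn N m))%:E); first by rewrite lee_fin uN ?leq_maxl.
by apply: ereal_sup_ubound; exists (maxn N m) => //; apply: mV; exact: leq_maxr.
Qed.

Lemma natr_gt (x : R) : exists n : nat, x < n.+1%:R.
Proof. by exists (Num.truncn x); exact: truncnS_gt. Qed.

Lemma nat_ratio_between (x y : R) : 0 <= x -> x < y ->
  exists u v : nat, [/\ (0 < v)%N, x < u%:R / v%:R & u%:R / v%:R < y].
Proof.
move=> x0 xy; have [n] := natr_gt (y - x)^-1; set v := n.+1%:R => lt_v.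
have v0 : 0 < v by rewrite ltr0n.
have /andP[le_t lt_t] := truncn_itv (mulr_ge0 x0 (ltW v0)).
exists (Num.truncn (x * v)).+1, n.+1; split=> //; rewrite -/v.
  by rewrite ltr_pdivlMr.
rewrite ltr_pdivrMr // -natr1.
have : 1 < (y - x) * v by rewrite mulrC -ltr_pdivrMr ?subr_gt0 // mul1r.
by nra.
Qed.

Lemma pow2_small (g : R) : 0 < g -> exists N : nat, 2%:R ^- N < g.
Proof.
move=> g0; have [n lt_n] := natr_gt g^-1; exists n.+1.
rewrite invf_plt ?posrE ?exprn_gt0 //; apply: lt_trans lt_n _.
by rewrite -natrX ltr_nat ltn_expl.
Qed.

(** Bernoulli's inequality at half the exponent, squared, gives growth quadratic in [v], which beats
    the linear left-hand side. *)
Lemma exp_dominates (h B : R) : 0 < h -> 0 < B ->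
  exists v0 : nat, forall v, (v0 <= v)%N -> B * (v.+1)%:R <= (1 + h) ^+ v.
Proof.
move=> h0 B0; have [J lt_J] := natr_gt (4 * B / h ^+ 2).
exists (J.+1).*2 => v le_v; pose j := v./2.
have jJ : (J.+1 <= j)%N by rewrite /j; lia.
have bern i : 1 + i%:R * h <= (1 + h) ^+ i.
  elim: i => [|i IH]; first by rewrite expr0 mul0r addr0.
  rewrite exprS; apply: (@le_trans _ _ ((1 + h) * (1 + i%:R * h))); last first.
    by rewrite ler_pM2l // addr_gt0.
  have : 0 <= i%:R :> R by [].
  rewrite -natr1; nra.
have J1 : J.+1%:R <= j%:R :> R by rewrite ler_nat.
have j1 : 1 <= j%:R :> R by rewrite ler1n; exact: leq_trans jJ.
have h2 : 0 < h ^+ 2 by rewrite exprn_gt0.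
have lt_j : 4 * B < j%:R * h ^+ 2.
  by rewrite -ltr_pdivrMr //; exact: lt_le_trans lt_J J1.
have sq : (j%:R * h) ^+ 2 <= (1 + h) ^+ v.
  apply: (@le_trans _ _ ((1 + h) ^+ (j * 2))); last first.
    by rewrite ler_weXn2l ?lerDl ?ltW // /j; lia.
  have c0 : 0 <= 1 + h by rewrite addr_ge0 // ltW.
  rewrite exprM lerXn2r ?nnegrE ?exprn_ge0 //.
    by rewrite mulr_ge0 // ltW.
  by apply: le_trans (bern j); rewrite lerDr ler01.
apply: le_trans sq.
have v1 : v.+1%:R <= 4 * j%:R :> R.
  by rewrite -natrM ler_nat /j; lia.
have : B * v.+1%:R <= B * (4 * j%:R) by rewrite ler_pM2l.
have : 4 * B * j%:R <= j%:R * h ^+ 2 * j%:R by rewrite ler_wpM2r // ltW.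
by rewrite !expr2; nra.
Qed.

(** A small bet on 1 at odds set between [q] and [p]. It cannot gain on average under forecasts up
    to [q], whereas under [p] its gain is of first order in the size of the bet and passing to the
    reciprocal costs only second order. *)
Lemma bet_constants (q p : R) : 0 <= q -> q < p -> p <= 1 ->
  exists A1 A0 D : nat, [/\ (0 < A1)%N, (0 < A0)%N, (0 < D)%N,
    forall r, r <= q -> r * (A1%:R / D%:R) + (1 - r) * (A0%:R / D%:R) <= 1
  & p * (D%:R / A1%:R) + (1 - p) * (D%:R / A0%:R) < 1].
Proof.
move=> q0 qp p1; have [u [v [v0 qu up]]] := nat_ratio_between q0 qp.
(* The factor on outcome x is 1 + (x - u/v)/(m+1), with m large. *)
have vR : 0 < v%:R :> R by rewrite ltr0n.
have pvu : 0 < p * v%:R - u%:R by rewrite subr_gt0 -ltr_pdivrMr.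
have uv : (u < v)%N.
  by rewrite -(ltr_nat R) -[X in _ < X]mul1r -ltr_pdivrMr //; exact: lt_le_trans p1.
(* With denominators cleared the last claim becomes [u * (v - u) < D * (p * v - u)] for
   [D = m.+1 * v], which fixes how large [m] must be. *)
have [m] := natr_gt (u%:R * (v%:R - u%:R) / (v%:R * (p * v%:R - u%:R))).
rewrite ltr_pdivrMr ?mulr_gt0 // => lt_m.
pose D := (m.+1 * v)%N; have D0 : (0 < D)%N by rewrite muln_gt0.
have uD : (u < D)%N by rewrite (leq_trans uv) // leq_pmull.
exists (D + (v - u))%N, (D - u)%N, D.
have A0 : (0 < D - u)%N by rewrite subn_gt0.
have A1 : (0 < D + (v - u))%N by rewrite addn_gt0 D0.
split=> //.
  move=> r rq; have ru : r * v%:R <= u%:R.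
    by rewrite -ler_pdivlMr //; apply: ltW; exact: le_lt_trans qu.
  rewrite !mulrA -mulrDl ler_pdivrMr ?ltr0n // mul1r natrD !natrB ?(ltnW uv) ?(ltnW uD) //.
  by nra.
have A0R : 0 < (D - u)%:R :> R by rewrite ltr0n.
have A1R : 0 < (D + (v - u))%:R :> R by rewrite ltr0n.
have -> : p * (D%:R / (D + (v - u))%:R) + (1 - p) * (D%:R / (D - u)%:R) =
    (p * D%:R * (D - u)%:R + (1 - p) * D%:R * (D + (v - u))%:R) /
    ((D + (v - u))%:R * (D - u)%:R).
  by field; rewrite -natrD !gt_eqF.
rewrite ltr_pdivrMr ?mulr_gt0 // mul1r natrD !natrB ?(ltnW uv) ?(ltnW uD) //.
have -> : D%:R = m.+1%:R * v%:R :> R by rewrite natrM.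
by lra.
Qed.

Lemma exists_rate (x : R) : x < 1 ->
  exists m : nat, (1 + m.+1%:R^-1) * x <= 1.
Proof.
move=> x1; have [m] := natr_gt (x / (1 - x)); rewrite ltr_pdivrMr ?subr_gt0 // => lt_m.
exists m; have m0 : 0 < m.+1%:R :> R by rewrite ltr0n.
have -> : (1 + m.+1%:R^-1) * x = (m.+1%:R * x + x) / m.+1%:R by field; rewrite gt_eqF.
by rewrite ler_pdivrMr // mul1r; nra.
Qed.

(** All constants are natural numbers and [a] is a finite function, so the possible choices form a
    countable type and can be listed before the path is built. In [a (b, x)], [b] is the outcome bet
    on and [x] the outcome that occurs. *)
Lemma betting_constants (lo hi q0 q1 : R) :
  0 <= lo -> lo < q0 -> q0 <= 1 -> 0 <= q1 -> q1 < hi -> hi <= 1 ->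
  exists (a : {ffun bool * bool -> nat}) (D m : nat),
  [/\ (0 < D)%N, forall z, (0 < a z)%N,
      forall r, r <= q1 ->
        r * ((a (true, true))%:R / D%:R) + (1 - r) * ((a (true, false))%:R / D%:R) <= 1,
      forall r, q0 <= r ->
        r * ((a (false, true))%:R / D%:R) + (1 - r) * ((a (false, false))%:R / D%:R) <= 1
    & forall b, let p := if b then hi else lo in
        (1 + m.+1%:R^-1) *
          (p * (D%:R / (a (b, true))%:R) + (1 - p) * (D%:R / (a (b, false))%:R)) <= 1].
Proof.
move=> lo0 loq q01 q10 qhi hi1.
have [A1 [A0 [D [A1p A0p Dp A_le A_lt]]]] := bet_constants q10 qhi hi1.
(* A bet on 0 is a bet on 1 with the outcomes exchanged, hence the complements of [q0] and [lo]. *)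
have [|||B1 [B0 [E [B1p B0p Ep B_le B_lt]]]] := @bet_constants (1 - q0) (1 - lo).
- by lra.
- by lra.
- by lra.
pose a := [ffun z : bool * bool => (if z.1 then (if z.2 then A1 else A0) * E
                          else (if z.2 then B0 else B1) * D)%N].
have A1R : A1%:R != 0 :> R by rewrite pnatr_eq0 -lt0n.
have A0R : A0%:R != 0 :> R by rewrite pnatr_eq0 -lt0n.
have B1R : B1%:R != 0 :> R by rewrite pnatr_eq0 -lt0n.
have B0R : B0%:R != 0 :> R by rewrite pnatr_eq0 -lt0n.
have DR : D%:R != 0 :> R by rewrite pnatr_eq0 -lt0n.
have ER : E%:R != 0 :> R by rewrite pnatr_eq0 -lt0n.
have [|m mP] := @exists_rate (Num.max
    (hi * (D%:R / A1%:R) + (1 - hi) * (D%:R / A0%:R))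
    ((1 - lo) * (E%:R / B1%:R) + (1 - (1 - lo)) * (E%:R / B0%:R))).
  by rewrite gt_max A_lt.
have c0 : 0 < 1 + m.+1%:R^-1 :> R by rewrite addr_gt0 // invr_gt0.
exists a, (D * E)%N, m; rewrite muln_gt0 Dp Ep; split=> //.
- by move=> [b x]; rewrite ffunE /=; case: b; case: x; rewrite muln_gt0 ?A1p ?A0p ?B1p ?B0p ?Dp ?Ep.
- move=> r /A_le; rewrite !ffunE /= !natrM.
  suff e (x : R) : x * E%:R / (D%:R * E%:R) = x / D%:R by rewrite !e.
  by field; rewrite DR ER.
- move=> r qr; have := B_le (1 - r); rewrite lerD2l lerN2 => /(_ qr).
  rewrite !ffunE /= !natrM opprB addrCA subrr addr0 addrC.
  suff e (x : R) : x * D%:R / (D%:R * E%:R) = x / E%:R by rewrite !e.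
  by field; rewrite DR ER.
- move=> b /=; apply: le_trans mP; rewrite ler_pM2l // le_max.
  case: b; rewrite !ffunE /= !natrM; apply/orP; [left|right].
    suff e (x : R) : x != 0 -> D%:R * E%:R / (x * E%:R) = D%:R / x by rewrite !e.
    by move=> x0; field; rewrite x0 ER.
  rewrite opprB addrCA subrr addr0 addrC.
  suff e (x : R) : x != 0 -> D%:R * E%:R / (x * D%:R) = E%:R / x by rewrite !e.
  by move=> x0; field; rewrite x0 DR.
Qed.

End Constants.

Section Capital.

Variables (R : realType) (b : situation -> bool) (k : nat).
Variables (a : {ffun bool * bool -> nat}) (D : nat).

(** Levels of other ranks get the factor [D / D], that is, no bet. *)
Definition stake (s : situation) (x : bool) : nat :=
  if rank (size s) == k then a (b s, x) else D.

Definition capital : real_process R :=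
  fun s => (path_prod stake s)%:R / (\prod_(i < size s) D)%:R.

Hypotheses (D_gt0 : (0 < D)%N) (a_gt0 : forall z, (0 < a z)%N).

Lemma stake_gt0 s x : (0 < stake s x)%N.
Proof. by rewrite /stake; case: ifP. Qed.

Lemma capital_nil : capital [::] = 1.
Proof. by rewrite /capital /path_prod !big_ord0 divr1. Qed.

Lemma capital_rcons s x :
  capital (rcons s x) = capital s * ((stake s x)%:R / D%:R).
Proof.
rewrite /capital path_prod_rcons size_rcons big_ord_recr /= !natrM.
by rewrite invfM mulrACA.
Qed.

Lemma capital_gt0 s : 0 < capital s.
Proof.
elim/last_ind: s => [|s x IH]; first by rewrite capital_nil.
by rewrite capital_rcons mulr_gt0 // divr_gt0 // ltr0n ?stake_gt0.
Qed.

Lemma computable_capital : rec b -> computable_process capital.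
Proof.
move=> rb; apply: (computable_ratio (num := path_prod stake)
  (den := fun s => path_prod (fun _ _ => D) s)) => //.
- apply: rec_path_prod; have rs := rec_size; have rr := rec_rank.
  have [|g rg ga] := @rec_finite _
      (fun z : bool * bool => Cantor.to_nat (nat_of_bool z.1, nat_of_bool z.2)) a.
    move=> [x y] [x' y'] /to_nat_pair_inj /= [].
    by case: x; case: x'; case: y; case: y'.
  have ra : rec (fun z : bool * bool => a z).
    apply: (@rec_ext _ _ _ _ (fun z => g (Cantor.to_nat (nat_of_bool z.1, nat_of_bool z.2)))) => //.
    by apply: (rec_app rg); apply: rec_cast.
  by rewrite /stake; rec_auto.
- by apply: rec_path_prod; rec_auto.
- by move=> s; rewrite /path_prod -lt0n prodn_gt0.
Qed.

(* Bounded exactly along the paths on which [capital] grows at least like the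
   numerator. *)
Definition counter m : real_process R :=
  fun s => (1 + m.+1%:R^-1) ^+ visits k (size s) / capital s.

Lemma counter_rcons m s x : counter m (rcons s x) =
  counter m s * (if rank (size s) == k then
                   (1 + m.+1%:R^-1) * (D%:R / (a (b s, x))%:R) else 1).
Proof.
have D0 : D%:R != 0 :> R by rewrite pnatr_eq0 -lt0n.
have c0 := capital_gt0 s; have a0 : (a (b s, x))%:R != 0 :> R by rewrite pnatr_eq0 -lt0n.
rewrite /counter size_rcons visitsS capital_rcons /stake.
case: ifP => _; last by rewrite addn0 mulr1 divff // mulr1.
have m0 : 1 + m%:R != 0 :> R by rewrite addrC natr1 pnatr_eq0.
by rewrite exprD expr1; field; rewrite a0 m0 D0 gt_eqF.
Qed.

Lemma counter_ge0 m s : 0 <= counter m s.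
Proof. by rewrite mulr_ge0 ?invr_ge0 ?exprn_ge0 ?addr_ge0 // ltW ?capital_gt0. Qed.

End Capital.

(** * Construction of the path and its randomness properties *)

Theorem theorem37 (R : realType) (A : set (real_process R))
    (hA : allowable A) (I : interval_forecast R) :
  exists w : bpath,
    [/\ random_for A (stationary I) w,
        schnorr_random (stationary I) w
      & forall phi : forecasting_system R, computable_fs phi ->
          sup (range (fun s : situation => ihi (phi s) - ilo (phi s)))
            < ihi I - ilo I ->
          ~ schnorr_random phi w /\ ~ random_for A phi w].
Proof.
case: hA => A_countable _ A_comp.
have [F FP] := rec_situation_bool_enumeration.
pose p s := if F (rank (size s)) s then ihi I else ilo I.
have lo0 := ilo_ge0 I; have lohi := ilo_le_ihi I; have hi1 := ihi_le1 I.
have pI s : ilo I <= p s <= ihi I by rewrite /p; case: ifP; rewrite lohi lexx.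
have p01 s : 0 <= p s <= 1.
  by have /andP[? ?] := pI s; rewrite (le_trans lo0) // (le_trans _ hi1).
pose U (z : nat * {ffun bool * bool -> nat} * nat * nat) : real_process R :=
  let: (k, a, D, m) := z in counter R (F k) k a D m.
(* Members of the families that are not supermartingales for [p] are discarded
   here, so that [U] may range over all constants. *)
pose C T := (A T \/ range U T) /\ (forall s, 0 <= T s) /\ fair p T.
have C_countable : countable C.
  apply: (@sub_countable _ _ _ (\bigcup_(i in [set: bool]) if i then A else range U)).
    apply: subset_card_le => T [[AT|UT] _]; first by exists true.
    by exists false.
  apply: bigcup_countable => // -[] _ //.
  by apply: sub_countable (card_image_le _ _) _.
have [||w wP] := bounded_path p01 C_countable.
- by move=> T [_ []].
- by move=> T [_ []].
have A_bounded T : A T -> test_supermartingale (stationary I) T ->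
    exists B, forall n, T (prefix_of w n) <= B.
  move=> AT [[T0 _] /supermartingaleP sT]; apply: wP; split; first by left.
  by split=> // s; apply: sT; exact: pI.
exists w; split.
- move=> T AT /(A_bounded T AT)[B TB].
  apply: (@le_lt_trans _ _ B%:E); last exact: ltry.
  by apply: ge_ereal_sup => _ [n _ <-]; rewrite lee_fin.
- move=> T [[T0 T1] /supermartingaleP sT] cT rho [_ rho_mono rho_unbd].
  (* [T] may vanish, so it need not belong to [A]. *)
  pose H s := (1 + T s) / 2.
  have H0 s : 0 < H s by rewrite divr_gt0 // ltr_pwDl.
  have tH : test_process H.
    by split=> [s|]; [exact: ltW | rewrite /H T1 divff].
  have AH : A H by apply: A_comp => //; exact: computable_half.
  have [|B HB] := A_bounded H AH.
    split=> //; apply/supermartingaleP => s q /(sT s q); rewrite /H => le_T; lra.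
  have [N0 lt_N0] := natr_gt (2 * B); have [N lt_N] := rho_unbd N0.
  apply: (@limn_esup_le0 _ _ N) => n le_n; rewrite subr_le0.
  have : (N0.+1%:R : R) <= (rho n)%:R by rewrite ler_nat (leq_trans lt_N) ?rho_mono.
  by have := HB n; rewrite /H; lra.
move=> phi [_ c_hi] width; set W := sup _ in width.
have le_W s : ihi (phi s) - ilo (phi s) <= W.
  apply: ub_le_sup; last by exists s.
  exists 1 => _ [t _ <-]; have := ilo_ge0 (phi t); have := ihi_le1 (phi t); lra.
have W0 : 0 <= W by apply: le_trans (le_W [::]); rewrite subr_ge0 ilo_le_ihi.
pose g := ihi I - ilo I - W; have g0 : 0 < g by rewrite subr_gt0.
have [N lt_N] : exists N : nat, 2%:R ^- N < g / 4 by apply: pow2_small; rewrite divr_gt0.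
have eta0 : 0 <= 2%:R ^- N :> R by rewrite invr_ge0 exprn_ge0.
(* A threshold in the middle half of the interval from [ilo I + W] to [ihi I] leaves room for [eta]
   on both sides: either [ihi (phi s) <= theta + eta < ihi I], or
   [ilo (phi s) >= theta - eta - W > ilo I] because [phi s] has width at most [W]. *)
have [||u [v [v0 lo_uv uv_hi]]] :=
  @nat_ratio_between R (ilo I + W + g / 4) (ilo I + W + 3 * g / 4).
- by rewrite !addr_ge0 // ltW // divr_gt0.
- lra.
have [b rb bP] := computable_threshold u N c_hi v0.
have [k Fk] := FP b rb.
set eta := 2%:R ^- N in lt_N eta0 bP; set theta := u%:R / v%:R in bP lo_uv uv_hi.
have gE : g = ihi I - ilo I - W by [].
have [||||||a [D [m [D0 a0 a_hi a_lo a_gain]]]] :=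
  @betting_constants R (ilo I) (ihi I) (theta - eta - W) (theta + eta); try lra.
pose T := capital R b k a D.
have T_pos s : 0 < T s by exact: capital_gt0.
have T_comp : computable_process T by exact: computable_capital.
have T_test : test_process T.
  by split=> [s|]; [exact: ltW | exact: capital_nil].
have T_super : test_supermartingale phi T.
  split=> //; apply/supermartingaleP => s q /andP[lq qu].
  rewrite /T !capital_rcons -/T mulrCA [(1 - q) * _]mulrCA -mulrDr ler_piMr ?(ltW (T_pos s)) //.
  rewrite /stake; case: ifP => _; last by rewrite -mulrDl addrC subrK mul1r divff // pnatr_eq0 -lt0n.
  have := bP s; have := le_W s; case: (b s) => le_Ws le_b.
    by apply: a_hi; exact: le_trans le_b.
  by apply: a_lo; apply: le_trans lq; lra.
(* At levels of rank [k] the forecast [p] follows [F k = b], so [a_gain] makes this counter fair for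
   [p]; it is among the processes kept bounded along [w]. *)
have [B UB] : exists B, forall n, U (k, a, D, m) (prefix_of w n) <= B.
  apply: wP; split; first by right; exists (k, a, D, m).
  split=> [s|s]; first exact: counter_ge0.
  rewrite /U !counter_rcons // Fk mulrCA [(1 - _) * _]mulrCA -mulrDr ler_piMr ?counter_ge0 //.
  case: ifP => [/eqP ek|_]; last by rewrite !mulr1 addrC subrK.
  apply: le_trans (a_gain (b s)); rewrite /p ek Fk /= le_eqVlt; apply/orP; left.
  by apply/eqP; ring.
have B0 : 0 < B.
  apply: lt_le_trans (UB 0%N); rewrite /U /= Fk /counter -/(T _).
  by rewrite divr_gt0 // exprn_gt0 // addr_gt0 // invr_gt0.
have h0 : 0 < m.+1%:R^-1 :> R by rewrite invr_gt0.
have [V VP] := exp_dominates h0 B0.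
have [_ mono unbd] := growth_visits k; have [n0 lt_n0] := unbd V.
(* Boundedness of the counter puts exponential growth in the number of visits below [B * T]. The
   extra 1 keeps the upper limit of [T] minus [visits k] at least 1. *)
have T_large n : (n0 <= n)%N -> (visits k n).+1%:R <= T (prefix_of w n).
  move=> le_n; have := UB n; rewrite /U Fk /counter /prefix_of size_mkseq -/(prefix_of w n) -/T.
  rewrite ler_pdivrMr // => le_T; rewrite -(ler_pM2l B0); apply: le_trans le_T.
  by apply: VP; apply: leq_trans (ltnW lt_n0) _; exact: mono.
split.
- move=> /(_ T T_super T_comp _ (growth_visits k)); apply/negP; rewrite -ltNge.
  apply: (@lt_le_trans _ _ 1%E); first exact: lte01.
  apply: (@limn_esup_ge1 _ _ n0) => n /T_large; rewrite -natr1; lra.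
- move=> /(_ T (A_comp _ T_test T_pos T_comp) T_super).
  set S := [set _ | _ in _]; have leS n : (0 < n)%N -> ((T (prefix_of w n))%:E <= ereal_sup S)%E.
    by move=> n_gt0; apply: ereal_sup_ubound; exists n.
  case E: (ereal_sup S) leS => [r| |] leS // _; last by have := leS 1%N isT.
  have [r1 lt_r] := natr_gt r; have [n1 lt_n1] := unbd r1.
  have := leS (maxn n0 n1).+1 isT; rewrite lee_fin.
  have := T_large (maxn n0 n1).+1 (leqW (leq_maxl _ _)).
  have : r1.+1%:R <= (visits k (maxn n0 n1).+1)%:R :> R.
    rewrite ler_nat (leq_trans lt_n1) // mono //; exact: leqW (leq_maxr _ _).
  rewrite -[(visits _ _).+1%:R]natr1; lra.
Qed.
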